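(* In $\mathrm{PG}(5,q)$, let $\mathbb S$ be an exterior splash with covers $\mathbb T$ and $\mathbb C$. Then in the cubic extension $\mathrm{PG}(5,q^3)$: 1. The cover $\mathbb T$ has exactly three transversal lines $g_{\mathbb T},g_{\mathbb T}^q,g_{\mathbb T}^{q^2}$, and these are contained in $\mathrm{PG}(5,q^3)\setminus\mathrm{PG}(5,q)$; and so $\mathbb T$ lies in a unique regular 2-spread. 2. The cover $\mathbb C$ has exactly three transversal lines $g_{\mathbb C},g_{\mathbb C}^q,g_{\mathbb C}^{q^2}$, and these are contained in $\mathrm{PG}(5,q^3)\setminus\mathrm{PG}(5,q)$; and so $\mathbb C$ lies in a unique regular 2-spread.
   Context: Let $q$ be a prime power, $\tau$ a primitive element of $\mathbb F_{q^3}$, and for $\alpha=a_0+a_1\tau+a_2\tau^2$ ($a_i\in\mathbb F_q$) write $[\alpha]=(a_0,a_1,a_2)$. A 2-spread of $\mathrm{PG}(5,q)$ is a set of $q^3+1$ planes partitioning the points. A 2-regulus is a set of $q+1$ mutually disjoint planes such that any line meeting three of them meets all of them. A 2-spread is regular if it contains the 2-regulus determined by any three of its planes. Bruck-Bose correspondence at infinity: let $\ell_\infty$ be the line $z=0$ of $\mathrm{PG}(2,q^3)$. A point $L=(\alpha,\beta,0)$ of $\ell_\infty$ corresponds to the plane $[L]=\{([\alpha x],[\beta x]): x\in\mathbb F_{q^3}\setminus\{0\}\}$ of $\mathrm{PG}(5,q)$. The planes $[L]$ form a regular 2-spread $\mathcal S$. An order-$q$-subplane $\pi$ of $\mathrm{PG}(2,q^3)$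 is an image of $\mathrm{PG}(2,q)$ under $\mathrm{PGL}(3,q^3)$. If $\pi$ is exterior to $\ell_\infty$ (no point of $\pi$ on $\ell_\infty$), then its exterior splash is the set of $q^2+q+1$ points of $\ell_\infty$ lying on extended lines of $\pi$; the same term and symbol $\mathbb S$ are used for the corresponding set of $q^2+q+1$ planes of $\mathcal S$. Covers: by a result of Bruck there are two further sets (switching sets) of $q^2+q+1$ planes of $\mathrm{PG}(5,q)$, called the covers of $\mathbb S$ and here denoted $\mathbb T$ and $\mathbb C$. Planes in the same set are disjoint, the planes of each of $\mathbb S,\mathbb T,\mathbb C$ cover the same set of points, and planes from different sets among $\mathbb S,\mathbb T,\mathbb C$ meet in exactly one point. Transversal lines: embed $\mathrm{PG}(5,q)$ in $\mathrm{PG}(5,q^3)$. A transversal line of a set of planes of $\mathrm{PG}(5,q)$ is a line of $\mathrm{PG}(5,q^3)$ meeting the extension of every plane of the set. For a line $g$ of $\mathrm{PG}(5,q^3)$, $g^q$ and $g^{q^2}$ denote its conjugates under the Frobenius map $X\mapsto X^q$ on coordinates. *)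

(* Defs.v *)
From HB Require Import structures.
From mathcomp Require Import all_boot all_order all_algebra all_field.
From mathcomp Require Import finmap.

Set Implicit Arguments.
Unset Strict Implicit.
Unset Printing Implicit Defensive.

Import GRing.Theory.
Local Open Scope ring_scope.
Local Open Scope fset_scope.

(* A projective subspace of PG(n-1, E) is a vector subspace of 'rV[E]_n: its
   points are the lines spanned by its nonzero vectors, and a projective
   subspace of dimension k has vector dimension k + 1. *)
Notation subsp E n := {vspace 'rV[E]_n}.

Section ProjectiveSpace.
Variables (E : fieldType) (n : nat).
Implicit Types U V : subsp E n.

Definition is_point U := \dim U = 1%N.
Definition is_line U := \dim U = 2%N.
Definition is_plane U := \dim U = 3%N.

Definition disjointv U V := (U :&: V)%VS = 0%VS.
Definition meets U V := (U :&: V)%VS <> 0%VS.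
Definition meets_in_point U V := is_point (U :&: V)%VS.

Definition mutually_disjoint (S : {fset subsp E n}) :=
  forall U V, U \in S -> V \in S -> U <> V -> disjointv U V.

Definition covered (S : {fset subsp E n}) (X : subsp E n) :=
  exists2 U, U \in S & (X <= U)%VS.

End ProjectiveSpace.

Section Spreads.
Variable F : finFieldType.
Implicit Types S R : {fset subsp F 6}.

Definition plane_set (m : nat) S :=
  #|` S| = m /\ forall P, P \in S -> is_plane P.

Definition is_spread S :=
  [/\ plane_set (#|F| ^ 3 + 1)%N S, mutually_disjoint S
    & forall X : subsp F 6, is_point X -> covered S X].

Definition is_regulus R :=
  [/\ plane_set (#|F| + 1)%N R, mutually_disjoint R
    & forall l P1 P2 P3 : subsp F 6, is_line l ->
        P1 \in R -> P2 \in R -> P3 \in R -> uniq [:: P1; P2; P3] ->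
        meets l P1 -> meets l P2 -> meets l P3 ->
        forall P, P \in R -> meets l P].

(* Three mutually disjoint planes of PG(5, q) lie in exactly one 2-regulus, the
   one they determine. *)
Definition is_regular_spread S :=
  is_spread S /\
  forall P1 P2 P3 : subsp F 6,
    P1 \in S -> P2 \in S -> P3 \in S -> uniq [:: P1; P2; P3] ->
    exists R, [/\ is_regulus R, [fset P1; P2; P3] `<=` R & R `<=` S].

(* T and C are the two covers of S.  These conditions determine the unordered
   pair {T, C} when S is an exterior splash. *)
Definition are_covers S T C :=
  [/\ plane_set (#|F| ^ 2 + #|F| + 1)%N T /\ plane_set (#|F| ^ 2 + #|F| + 1)%N C,
      mutually_disjoint T /\ mutually_disjoint C,
      forall X : subsp F 6, is_point X ->
        (covered T X <-> covered S X) /\ (covered C X <-> covered S X)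
    & [/\ forall P Q, P \in S -> Q \in T -> meets_in_point P Q,
          forall P Q, P \in S -> Q \in C -> meets_in_point P Q
        & forall P Q, P \in T -> Q \in C -> meets_in_point P Q]].

End Spreads.

Section CubicExtension.
Variables (F : finFieldType) (L : fieldExtType F).

Definition embed n (v : 'rV[F]_n) : 'rV[L]_n := map_mx (in_alg L) v.

Definition extend n (U : subsp F n) : subsp L n :=
  <<[seq embed v | v <- vbasis U]>>%VS.

(* The image of U under x |-> x ^ q on coordinates: this map is semilinear, so
   the image of U is spanned by the image of a basis of U. *)
Definition conjv n (U : subsp L n) : subsp L n :=
  <<[seq map_mx (fun x : L => x ^+ #|F|)%R v | v <- vbasis U]>>%VS.

Definition is_transversal (T : {fset subsp F 6}) (g : subsp L 6) :=
  is_line g /\ forall P, P \in T -> meets g (extend P).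

Definition avoids_base n (g : subsp L n) :=
  forall v : 'rV[F]_n, v != 0 -> embed v \notin g.

Definition has_exactly_three_transversals (T : {fset subsp F 6}) :=
  exists g : subsp L 6,
    let gs := [:: g; conjv g; conjv (conjv g)] in
    [/\ uniq gs, forall h, is_transversal T h <-> h \in gs
      & forall h, h \in gs -> avoids_base h].

Definition pt_inf (a b : L) : subsp L 3 :=
  <[\row_(i < 3) [:: a; b; 0]`_i]>%VS.

Definition on_linf (X : subsp L 3) :=
  exists a b : L, (a, b) != (0, 0) /\ X = pt_inf a b.

Definition is_subplane (pi : {fset subsp L 3}) :=
  exists2 A : 'M[L]_3, A \in unitmx
    & forall X : subsp L 3,
        X \in pi <-> exists2 v : 'rV[F]_3, v != 0 & X = <[embed v *m A]>%VS.

Definition is_exterior (pi : {fset subsp L 3}) :=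
  forall X, X \in pi -> ~ on_linf X.

Definition in_splash (pi : {fset subsp L 3}) (X : subsp L 3) :=
  on_linf X /\
  exists P Q, [/\ P \in pi, Q \in pi, P <> Q & (X <= P + Q)%VS].

Variable tau : L.

(* [alpha] = (a0, a1, a2), where alpha = a0 + a1 tau + a2 tau^2. *)
Definition bracket (alpha : L) : 'rV[F]_3 :=
  \row_(i < 3) coord [tuple 1; tau; tau ^+ 2] i alpha.

Definition bb_vec (a b x : L) : 'rV[F]_6 :=
  row_mx (bracket (a * x)) (bracket (b * x)).

Fact bb_vec_is_linear a b : linear (bb_vec a b).
Proof.
move=> k x y; apply/rowP=> i; rewrite !mxE.
by case: split => j; rewrite !mxE mulrDr -scalerAr linearP.
Qed.

HB.instance Definition _ a b :=
  GRing.isLinear.Build F L 'rV[F]_6 _ (bb_vec a b) (bb_vec_is_linear a b).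

Definition bb_plane (a b : L) : subsp F 6 := limg (linfun (bb_vec a b)).

Fact mem_bb_plane a b v :
  v \in bb_plane a b <-> exists x, v = row_mx (bracket (a * x)) (bracket (b * x)).
Proof.
split=> [/memv_imgP[x _ ->]|[x ->]]; first by exists x; rewrite lfunE.
by apply/memv_imgP; exists x; rewrite ?memvf ?lfunE.
Qed.

Definition is_exterior_splash (S : {fset subsp F 6}) :=
  exists pi : {fset subsp L 3},
    [/\ is_subplane pi, is_exterior pi
      & forall P, P \in S <->
          exists a b : L, [/\ (a, b) != (0, 0), in_splash pi (pt_inf a b)
                            & P = bb_plane a b]].

End CubicExtension.

Arguments has_exactly_three_transversals {F} L T.

(* Main.v *)
Require Import Defs.
From HB Require Import structures.
From mathcomp Require Import all_boot all_order all_algebra all_fingroup all_solvable.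
From mathcomp Require Import all_field.
From mathcomp Require Import finmap ring zify.

Set Implicit Arguments.
Unset Strict Implicit.
Unset Printing Implicit Defensive.

Import GRing.Theory.
Local Open Scope ring_scope.

(** Points of PG(5,q) are represented by pairs (x, y) of L * L, through an
F-linear bijection Th from L * L to F^6, called a frame; [plane Th a b] is the
plane of all Th (a z, b z). Put n = q^2 + q + 1; the elements of L of norm 1
over F are the n solutions of k^n = 1. The proof reduces everything to a single
configuration, the norm-1 planes y = k x with k^n = 1.

Splash. Every F-linear map on L is a combination of x, x^q and x^(q^2)
([linear_expansion]). Hence an exterior subplane, parametrized by its third
coordinate x, consists of the points x e0 + x^q e1 + x^(q^2) e2, where e1 and e2
span the line at infinity. The line joining the points of parameters x and y
meets it in D e1 - D^(q^2) e2 with D = y x^q - x y^q, and the ratios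
D^(q^2) / D are exactly the elements of norm 1, by Hilbert 90. So the splash is
the set of norm-1 planes of a frame ([splash_frame]).

Covers. A cover plane is the graph of an F-linear map f, and, since it meets
every splash plane in one point, f(x) / x takes every value of norm 1 exactly
once when x runs through the n points of L modulo F. Comparing the sum of these
values, and the sum of their (q+1)-st powers, with the same power sums over the
n-th roots of unity shows that f(x) is k x^q or k x^(q^2)
([slope_monomial]). Graphs of the two kinds always meet, so one cover uses a
single kind, and applying a power of the Frobenius map to the first coordinate
turns it into the norm-1 planes of another frame ([cover_frame]). It remains to
prove the conclusions for the norm-1 planes.

Transversals. Over L the frame gives coordinates X_i, Y_i (i < 3) in which the
point Th (x, y) has X_i = x^(q^i) and Y_i = y^(q^i), so that the extension of
y = k x has the equations Y_i = k^(q^i) X_i. The three conjugate lines on which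
only X_i and Y_i are nonzero are transversals. Conversely, that a line meets
all these planes says that certain polynomials in k with four monomials of
degree less than n vanish at n points. All Pluecker coordinates of the line are
then zero, except those of the three pairs (X_i, Y_i), and the line is one of
the three ([transversal_is_axis_line]).

Regular spreads. The planes y = k x with k in L, together with x = 0, form a
regular spread: by the action of GL(2, L) three of them can be moved to y = 0,
x = 0 and y = x, which lie in the regulus of all y = t x with t in F. This
regulus is the only one through these three planes ([regulus_unique]). Let R be
a regular spread that contains the norm-1 planes. If q > 2, move y = x to
infinity: the slopes of the planes of R then form a subset of L that is closed
under affine F-lines and has at least q^2 + q elements, hence is L. If q = 2,
the norm-1 planes cover all points off the planes x = 0 and y = 0, and a
plane contained in the union of two planes is one of them
([regular_spread_unique]). *)

(** * Finite fields and the Frobenius map *)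

Section Cardinality.
Variable F : finFieldType.
Local Notation q := #|F|.
Local Notation n := (#|F| ^ 2 + #|F| + 1)%N.

Lemma card_gt1 : (1 < q)%N. Proof. exact: finNzRing_gt1. Qed.

(** The norm of x over F is x^n, and F^* is the subgroup of index n of L^*. *)
Lemma q3_factor : (q ^ 3 - 1 = (q - 1) * n)%N.
Proof. have := card_gt1; nia. Qed.

Lemma lt_2q1_n : (q + q + 1 < n)%N.
Proof.
have q1 := card_gt1; have : (q < q ^ 2)%N by rewrite -[X in (X < _)%N]expn1 ltn_exp2l.
by lia.
Qed.

End Cardinality.

Section Frobenius.
Variables (F : finFieldType) (L : fieldExtType F).

Definition frobenius (x : L) : L := x ^+ #|F|.

Lemma card_pnat p : p \in [pchar F] -> p.-nat #|F|.
Proof.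
by move=> pcharF; rewrite -cardsT; apply/abelem_pgroup/fin_ring_pchar_abelem.
Qed.

Fact frobenius_is_zmod_morphism : zmod_morphism frobenius.
Proof.
move=> x y; have [p p_prime pcharF] := finPcharP F.
have pcharL : p \in [pchar L] by rewrite (fmorph_pchar (in_alg L)).
have qnat : [pchar L].-nat #|F|.
  by rewrite (eq_pnat _ (pcharf_eq pcharL)) card_pnat.
by rewrite /frobenius exprDn_pchar // exprNn_pchar.
Qed.

Fact frobenius_is_monoid_morphism : monoid_morphism frobenius.
Proof. by split=> [|x y]; rewrite /frobenius ?expr1n ?exprMn. Qed.

HB.instance Definition _ :=
  GRing.isZmodMorphism.Build L L frobenius frobenius_is_zmod_morphism.
HB.instance Definition _ :=
  GRing.isMonoidMorphism.Build L L frobenius frobenius_is_monoid_morphism.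

Lemma in_alg_expq (c : F) i : c%:A ^+ (#|F| ^ i) = c%:A :> L.
Proof.
elim: i => [|i IHi]; first by rewrite expr1.
rewrite expnSr exprM IHi -[c%:A]/(in_alg L c) -rmorphXn /=.
by rewrite expf_card.
Qed.

Lemma expqD i (x y : L) : (x + y) ^+ (#|F| ^ i) = x ^+ (#|F| ^ i) + y ^+ (#|F| ^ i).
Proof.
elim: i => [|i IHi]; first by rewrite !expr1.
by rewrite expnSr !exprM IHi -!/(frobenius _) rmorphD.
Qed.

Lemma expqZ i (c : F) (x : L) : (c *: x) ^+ (#|F| ^ i) = c *: x ^+ (#|F| ^ i).
Proof. by rewrite -mulr_algl exprMn in_alg_expq mulr_algl. Qed.

Lemma expqN i (x : L) : (- x) ^+ (#|F| ^ i) = - x ^+ (#|F| ^ i).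
Proof. by rewrite -scaleN1r expqZ scaleN1r. Qed.

Lemma natr_card_eq0 : #|F|%:R = 0 :> L.
Proof.
have [p p_prime pcharF] := finPcharP F.
have pcharL : p \in [pchar L] by rewrite (fmorph_pchar (in_alg L)).
apply/eqP; rewrite -(dvdn_pcharf pcharL).
case/p_natP: (card_pnat pcharF) => [[|k]] qE.
  by have := finNzRing_gt1 F; rewrite qE.
by rewrite qE expnS dvdn_mulr.
Qed.

End Frobenius.

(** * Powers of a primitive element *)

Section PrimitiveElement.
Variables (F : finFieldType) (L : fieldExtType F) (tau : L).
Hypothesis tau_prim : (#|F| ^ 3 - 1)%N.-primitive_root tau.
Local Notation q := #|F|.
Local Notation n := (#|F| ^ 2 + #|F| + 1)%N.

(** A generator of the group of elements of norm 1. *)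
Definition zeta := tau ^+ (q - 1).

Lemma zeta_prim : n.-primitive_root zeta.
Proof.
have := dvdn_prim_root tau_prim (m := n).
rewrite q3_factor dvdn_mull // mulnK; last by rewrite addn1.
by apply.
Qed.

Lemma tau_neq0 : tau != 0.
Proof. by rewrite (prim_root_eq0 tau_prim); have := card_gt1 F; nia. Qed.

Lemma n_eq1 : n%:R = 1 :> L.
Proof. by rewrite !natrD natrX natr_card_eq0 expr0n !add0r. Qed.

Lemma sum_unity (w : L) : w ^+ n = 1 -> w != 1 -> \sum_(j < n) w ^+ j = 0.
Proof.
move=> wn w1; have := subrX1 w n; rewrite wn subrr => /esym/eqP.
by rewrite mulf_eq0 subr_eq0 (negPf w1) => /eqP.
Qed.

Lemma zetaX_neq1 m : (0 < m < n)%N -> zeta ^+ m != 1.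
Proof.
case/andP=> m0 mn; rewrite -(prim_order_dvd zeta_prim).
by rewrite gtnNdvd.
Qed.

Lemma sum_zeta m : (0 < m < n)%N -> \sum_(j < n) (zeta ^+ m) ^+ j = 0.
Proof.
move=> mn; apply: sum_unity (zetaX_neq1 mn).
by rewrite exprAC (prim_expr_order zeta_prim) expr1n.
Qed.

(** The norm of tau lies in F, hence is fixed by the Frobenius map. *)
Lemma exp_tau_n i : (tau ^+ n) ^+ (q ^ i) = tau ^+ n.
Proof.
have fixn : (tau ^+ n) ^+ q = tau ^+ n.
  have -> : (tau ^+ n) ^+ q = tau ^+ n * (tau ^+ n) ^+ (q - 1).
    by rewrite -exprS subn1 prednK // ltnW // card_gt1.
  by rewrite -exprM mulnC -q3_factor (prim_expr_order tau_prim) mulr1.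
by elim: i => [|i IHi]; rewrite ?expr1 // [(q ^ i.+1)%N]expnSr exprM IHi.
Qed.

Lemma exp_tau_inj i j : (i < 3)%N -> (j < 3)%N ->
  (tau ^+ (q ^ i) == tau ^+ (q ^ j)) = (i == j).
Proof.
have small l : (l < 3)%N -> (q ^ l < q ^ 3 - 1)%N.
  rewrite ltnS => l2; have q1 := card_gt1 F.
  apply: (leq_ltn_trans (n := q ^ 2)); first by rewrite leq_exp2l.
  by have := lt_2q1_n F; rewrite q3_factor; nia.
move=> /small ltn_i /small ltn_j; rewrite (eq_prim_root_expr tau_prim).
by rewrite !modn_small // eqn_exp2l // card_gt1.
Qed.

(** Orthogonality of the Frobenius powers. The summand does not change when
tau^j is multiplied by an element of F, so a sum over representatives of
L^* / F^* stands for the sum over L^*, which would be its q - 1 = -1 multiple. *)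
Lemma sum_expq i l : (i < 3)%N -> (l < 3)%N ->
  \sum_(j < n) (tau ^+ j) ^- (q ^ i) * (tau ^+ j) ^+ (q ^ l) = (i == l)%:R.
Proof.
move=> i3 l3; pose w := tau ^- (q ^ i) * tau ^+ (q ^ l).
transitivity (\sum_(j < n) w ^+ j).
  apply: eq_bigr => j _; rewrite /w exprMn exprVn.
  by rewrite !(exprAC _ j).
have [il|il] := eqVneq i l.
  rewrite /w il mulVf ?expf_neq0 ?tau_neq0 //.
  under eq_bigr do rewrite expr1n.
  by rewrite sumr_const card_ord n_eq1.
apply: sum_unity.
  rewrite exprMn exprVn !(exprAC _ _ n) !exp_tau_n mulVf //.
  by rewrite expf_neq0 ?tau_neq0.
rewrite -(inj_eq (mulfI (expf_neq0 (q ^ i) tau_neq0))) mulr1 mulrA mulfV.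
  by rewrite mul1r eq_sym exp_tau_inj.
by rewrite expf_neq0 ?tau_neq0.
Qed.

End PrimitiveElement.

(** * Linear maps on a cubic extension *)

Section CubicField.
Variables (F : finFieldType) (L : fieldExtType F).
Hypothesis dimL : \dim {:L} = 3%N.
Variable tau : L.
Hypothesis tau_prim : (#|F| ^ 3 - 1)%N.-primitive_root tau.
Local Notation q := #|F|.
Local Notation n := (#|F| ^ 2 + #|F| + 1)%N.

Lemma expq3 (x : L) : x ^+ (q ^ 3) = x.
Proof.
rewrite -dimL; have := memvf x.
by rewrite (Fermat's_little_theorem {:L}%AS) => /eqP.
Qed.

Lemma expq_fixed (x : L) : x ^+ q = x -> exists c : F, x = c%:A.
Proof.
move=> xq; have : x \in 1%AS.
  by rewrite (Fermat's_little_theorem 1%AS) dimv1 expn1 xq.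
by move=> /vlineP [c ->]; exists c.
Qed.

Lemma tauP (x : L) : x != 0 -> exists i, x = tau ^+ i.
Proof.
move=> x0; have : x ^+ (q ^ 3 - 1) = 1.
  apply: (mulfI x0); rewrite -exprS mulr1 subn1 prednK ?expq3 //.
  by rewrite expn_gt0 ltnW ?card_gt1.
by case/(prim_rootP tau_prim) => i ->; exists i.
Qed.

Lemma trace_in_base (y : L) : exists c : F, \sum_(i < 3) y ^+ (q ^ i) = c%:A.
Proof.
apply: expq_fixed; rewrite -/(frobenius _) rmorph_sum /=.
rewrite !big_ord_recl !big_ord0 /= !addr0 /frobenius -!exprM -!expnSr /= expq3.
by rewrite [RHS]addrC addrA expn0 expr1.
Qed.

(** The coefficient of x^(q^i) in phi, extracted with [sum_expq]. *)
Definition qcoef (W : lmodType L) (phi : L -> W) (i : nat) :=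
  \sum_(j < n) (tau ^+ j) ^- (q ^ i) *: phi (tau ^+ j).

(** After exchanging the sums, the right hand side is the sum over j of
phi (Tr (x / tau^j) tau^j), because the traces lie in F; the same
orthogonality relation, applied inside phi, recovers x. *)
Lemma linear_expansion (W : lmodType L) (phi : L -> W) :
    (forall (c : F) x y, phi (c *: x + y) = c%:A *: phi x + phi y) ->
  forall x, phi x = \sum_(i < 3) x ^+ (q ^ i) *: qcoef phi i.
Proof.
move=> phiP x.
have phi0 : phi 0 = 0.
  by have := phiP (-1) 0 0; rewrite scaler0 add0r scaleN1r scaleN1r addNr.
have phiZ c y : phi (c *: y) = c%:A *: phi y.
  by have := phiP c y 0; rewrite !addr0 phi0 addr0.
have phiD y z : phi (y + z) = phi y + phi z.
  by have := phiP 1 y z; rewrite !scale1r.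
have phiT y z : (\sum_(i < 3) y ^+ (q ^ i)) *: phi z =
                phi ((\sum_(i < 3) y ^+ (q ^ i)) * z).
  by have [c ->] := trace_in_base y; rewrite mulr_algl phiZ.
under eq_bigr do rewrite /qcoef scaler_sumr.
rewrite exchange_big /=.
transitivity (\sum_(j < n) phi ((\sum_(i < 3) (x / tau ^+ j) ^+ (q ^ i)) * tau ^+ j)).
  rewrite -(big_morph phi phiD phi0); congr phi.
  under eq_bigr do rewrite mulr_suml.
  rewrite exchange_big /=.
  transitivity (\sum_(i < 3) x ^+ (q ^ i) * (i == 0 :> nat)%:R).
    by rewrite !big_ord_recl big_ord0 /= !mulr0 !addr0 mulr1 expr1.
  apply: eq_bigr => i _; rewrite -(@sum_expq _ _ _ tau_prim i 0) // mulr_sumr.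
  by apply: eq_bigr => j _; rewrite exprMn exprVn mulrA expr1.
apply: eq_bigr => j _; rewrite -phiT scaler_suml; apply: eq_bigr => i _.
by rewrite scalerA exprMn exprVn.
Qed.

End CubicField.

(** * Planes and pencils of planes in a frame *)

Section Planes.
Variables (F : finFieldType) (L : fieldExtType F).
Hypothesis dimL : \dim {:L} = 3%N.
Local Notation q := #|F|.
Local Notation frame := 'Hom((L * L)%type, 'rV[F]_6).
Implicit Types (Th : frame) (a b c d k x y : L).

Definition homothety a b x : L * L := (a * x, b * x).

Fact homothety_is_linear a b : linear (homothety a b).
Proof. by move=> c x y; rewrite /homothety !mulrDr -!scalerAr. Qed.

HB.instance Definition _ a b :=
  GRing.isLinear.Build F L (L * L)%type _ (homothety a b)
    (homothety_is_linear a b).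

(** The point (a : b) of PG(1, L) as a plane: for the coordinates of the
Bruck-Bose correspondence it is the plane of the spread at infinity that
represents (a, b, 0). *)
Definition plane Th a b : subsp F 6 := (Th @: limg (linfun (homothety a b)))%VS.

Lemma planeP Th a b v :
  reflect (exists x, v = Th (a * x, b * x)) (v \in plane Th a b).
Proof.
apply: (iffP memv_imgP) => [[p /memv_imgP[x _ ->] ->]|[x ->]].
  by exists x; rewrite lfunE.
exists (a * x, b * x) => //; apply/memv_imgP; exists x; first exact: memvf.
by rewrite lfunE.
Qed.

Lemma eq_plane Th Th' a b a' b' :
  (forall x, exists y, Th (a * x, b * x) = Th' (a' * y, b' * y)) ->
  (forall x, exists y, Th' (a' * x, b' * x) = Th (a * y, b * y)) ->
  plane Th a b = plane Th' a' b'.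
Proof.
move=> H1 H2; apply/vspaceP=> v; apply/planeP/planeP => -[x ->].
  by have [y ->] := H1 x; exists y.
by have [y ->] := H2 x; exists y.
Qed.

Lemma plane_scale Th a b c : c != 0 -> plane Th (a * c) (b * c) = plane Th a b.
Proof.
move=> c0; apply: eq_plane => x; first by exists (c * x); rewrite !mulrA.
by exists (c^-1 * x); rewrite -!mulrA !(mulrA c) divff // mul1r.
Qed.

Section Frame.
Variable Th : frame.
Hypothesis Th0 : lker Th == 0%VS.

Lemma frame_inj : injective Th. Proof. exact/lker0P. Qed.

Lemma frame_surj v : exists x y, v = Th (x, y).
Proof.
have : v \in limg Th.
  suff -> : limg Th = fullv by exact: memvf.
  apply/eqP; rewrite eqEdim subvf limg_dim_eq; last by rewrite (eqP Th0) capv0.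
  rewrite !dimvf dim_matrix -[dim (L * L)%type]/(dim L + dim L)%N.
  by rewrite -[dim L]dimvf dimL.
by case/memv_imgP=> -[x y] _ ->; exists x, y.
Qed.

Lemma frame_eq0 x y : Th (x, y) = 0 -> x = 0 /\ y = 0.
Proof. by rewrite -(linear0 Th) => /frame_inj [-> ->]. Qed.

Lemma dim_plane a b : (a, b) != (0, 0) -> \dim (plane Th a b) = 3%N.
Proof.
move=> ab; rewrite limg_dim_eq; last by rewrite (eqP Th0) capv0.
rewrite limg_dim_eq ?dimL //; apply/eqP; rewrite -subv0; apply/subvP => x.
rewrite memv_cap memvf memv_ker lfunE /= xpair_eqE !mulf_eq0 memv0.
by apply: contraLR => x0; rewrite (negPf x0) !orbF -xpair_eqE.
Qed.

Lemma plane_disjoint a b c d :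
  a * d != b * c -> disjointv (plane Th a b) (plane Th c d).
Proof.
move=> det; apply/eqP; rewrite -subv0; apply/subvP => v.
rewrite memv_cap memv0 => /andP[/planeP[x ->] /planeP[y]].
move=> /frame_inj [e1 e2]; have : (a * d - b * c) * x = 0.
  by rewrite mulrBl (mulrAC a) (mulrAC b) e1 e2; ring.
move=> /eqP; rewrite mulf_eq0 subr_eq0 (negPf det) /= => /eqP ->.
by rewrite !mulr0 (linear0 Th).
Qed.

Lemma plane_inj a b c d :
  (a, b) != (0, 0) -> plane Th a b = plane Th c d -> a * d = b * c.
Proof.
move=> ab e; apply/eqP; apply: contraT => /plane_disjoint.
by rewrite /disjointv -e capvv => e0; have := dim_plane ab; rewrite e0 dimv0.
Qed.

Lemma plane1_inj k k' : plane Th 1 k = plane Th 1 k' -> k = k'.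
Proof.
move=> /plane_inj; rewrite mul1r mulr1 => -> //.
by rewrite xpair_eqE oner_eq0.
Qed.

Lemma plane_eq a b c d :
  (a, b) != (0, 0) -> (c, d) != (0, 0) -> a * d = b * c ->
  plane Th a b = plane Th c d.
Proof.
have half a' b' c' d' : (a', b') != (0, 0) -> a' * d' = b' * c' ->
    exists e, c' = a' * e /\ d' = b' * e.
  rewrite xpair_eqE negb_and; have [a0|a0 _ e] /= := eqVneq a' 0.
    rewrite a0 mul0r => b0 /esym/eqP; rewrite mulf_eq0 (negPf b0) /= => /eqP ->.
    by exists (d' / b'); rewrite mul0r mulrC divfK.
  by exists (c' / a'); rewrite mulrC divfK // mulrA -e mulrC mulKf.
move=> ab cd e; apply: eq_plane => x.
  have [|u [-> ->]] := half c d a b cd; first by rewrite mulrC -e mulrC.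
  by exists (u * x); rewrite !mulrA.
have [u [-> ->]] := half a b c d ab e.
by exists (u * x); rewrite !mulrA.
Qed.

End Frame.

Section Meets.
Variables (K : fieldType) (m : nat).
Implicit Types U V : subsp K m.

Lemma meetsP U V : meets U V <-> exists v, [/\ v != 0, v \in U & v \in V].
Proof.
split=> [/eqP UV|[v [v0 vU vV]] e].
  exists (vpick (U :&: V)); rewrite vpick0 UV.
  by have := memv_pick (U :&: V); rewrite memv_cap => /andP[].
have : v \in (U :&: V)%VS by rewrite memv_cap vU.
by rewrite e memv0 (negPf v0).
Qed.

Lemma disjointvP U V v : disjointv U V -> v \in U -> v \in V -> v = 0.
Proof.
move=> e vU vV; have : v \in (U :&: V)%VS by rewrite memv_cap vU.
by rewrite e memv0 => /eqP.
Qed.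

End Meets.

Lemma line_span (K : fieldType) m (l : subsp K m) u v w :
  is_line l -> u \in l -> v \in l -> w \in l -> free [:: u; v] ->
  exists r s, w = r *: u + s *: v.
Proof.
move=> dl ul vl wl fr; have lE : l = <<[:: u; v]>>%VS.
  apply/esym/eqP; rewrite eqEdim dl (eqP fr) /= andbT.
  by apply/span_subvP => z; rewrite !inE => /orP[] /eqP ->.
move: wl; rewrite lE span_cons span_seq1 => /memv_addP[_ /vlineP[r ->]].
by case=> _ /vlineP[s ->] ->; exists r, s.
Qed.

(** Affine slopes K together with the slope at infinity. Taking for K the
elements of F gives a regulus, taking all of L gives a regular spread. *)
Definition pencil Th (K : seq L) : {fset subsp F 6} :=
  [fset P in plane Th 0 1 :: [seq plane Th 1 k | k <- K]]%fset.

Definition base_scalars : seq L := [seq r%:A | r <- enum F].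
Definition all_scalars : seq L := enum (finvect_type L).
Definition subline_regulus Th := pencil Th base_scalars.
Definition line_spread Th := pencil Th all_scalars.

Lemma uniq_base_scalars : uniq base_scalars.
Proof. by rewrite map_inj_uniq ?enum_uniq //; apply: (fmorph_inj (in_alg L)). Qed.

Lemma mem_base_scalars k : reflect (exists c : F, k = c%:A) (k \in base_scalars).
Proof.
by apply: (iffP mapP) => -[c]; [move=> _ ->; exists c | exists c; rewrite ?mem_enum].
Qed.

Lemma uniq_all_scalars : uniq all_scalars. Proof. exact: enum_uniq. Qed.

Lemma mem_all_scalars k : k \in all_scalars.
Proof. by rewrite (mem_enum (finvect_type L)). Qed.

Lemma size_all_scalars : size all_scalars = (q ^ 3)%N.
Proof.
transitivity #|finvect_type L|; first exact/esym/(cardE (finvect_type L)).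
by rewrite -[in RHS]dimL -(@card_vspace F (finvect_type L)) card_vspacef.
Qed.

Section Pencil.
Variable Th : frame.
Hypothesis Th0 : lker Th == 0%VS.

Lemma pencilP K P :
  reflect (P = plane Th 0 1 \/ exists2 k, k \in K & P = plane Th 1 k)
          (P \in pencil Th K).
Proof.
rewrite !inE /=; apply: (iffP orP) => [[/eqP|/mapP]|[->|[k kK ->]]]; auto.
by right; apply: map_f.
Qed.

Lemma pair10 k : (1, k) != (0, 0) :> L * L.
Proof. by rewrite xpair_eqE oner_eq0. Qed.

Lemma pair01 : (0, 1) != (0, 0) :> L * L.
Proof. by rewrite xpair_eqE oner_eq0 andbF. Qed.

Lemma plane_set_pencil K : uniq K -> plane_set (size K + 1) (pencil Th K).
Proof.
move=> uK; split; last first.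
  by move=> P /pencilP[->|[k _ ->]]; apply: dim_plane; rewrite ?pair10 ?pair01.
rewrite card_fseq undup_id /= ?size_map ?addn1 //.
rewrite map_inj_uniq ?uK ?andbT; last exact: plane1_inj.
apply/mapP => -[k _ /(plane_inj Th0 pair01)].
by rewrite mul0r mulr1 => /eqP; rewrite eq_sym oner_eq0.
Qed.

Lemma mutually_disjoint_pencil K : mutually_disjoint (pencil Th K).
Proof.
move=> P Q /pencilP[->|[k _ ->]] /pencilP[->|[k' _ ->]] // ne;
  apply: plane_disjoint; rewrite // ?mul0r ?mul1r ?mulr1 ?oner_eq0 //.
- by rewrite eq_sym oner_eq0.
- by rewrite mulr0 oner_eq0.
by apply/eqP=> kk; case: ne; rewrite kk.
Qed.

Lemma line_spreadP P :
  P \in line_spread Th <-> exists a b, (a, b) != (0, 0) /\ P = plane Th a b.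
Proof.
split=> [/pencilP[->|[k _ ->]]|[a [b [ab ->]]]].
- by exists 0, 1; rewrite pair01.
- by exists 1, k; rewrite pair10.
apply/pencilP; have [a0|a0] := eqVneq a 0.
  by left; apply: plane_eq; rewrite ?pair01 // a0 mulr0 mul0r in ab *.
right; exists (b / a); first exact: mem_all_scalars.
by apply: plane_eq; rewrite ?pair10 // mulr1 mulrC divfK.
Qed.

Lemma subline_regulusP P :
  P \in subline_regulus Th <->
  exists s t : F, (s, t) != (0, 0) /\ P = plane Th s%:A t%:A.
Proof.
split=> [/pencilP[->|[k /mem_base_scalars[c ->] ->]]|[s [t [st ->]]]].
- by exists 0, 1; rewrite scale0r scale1r xpair_eqE oner_eq0 andbF.
- by exists 1, c; rewrite scale1r xpair_eqE oner_eq0.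
have algF : injective (in_alg L) by apply: fmorph_inj.
have ab : (s%:A, t%:A) != (0, 0) :> L * L.
  by rewrite xpair_eqE -!(raddf0 (in_alg L)) !(inj_eq algF) -xpair_eqE.
apply/pencilP; have [s0|s0] := eqVneq s 0.
  by left; apply: plane_eq; rewrite ?pair01 // s0 scale0r mulr0 mul0r.
right; exists (t / s)%:A; first by apply/mem_base_scalars; exists (t / s).
apply: plane_eq; rewrite ?pair10 // mulr1.
by rewrite -[LHS]/(in_alg L s * in_alg L (t / s)) -rmorphM mulrC divfK.
Qed.

End Pencil.
End Planes.

(** * Reguli and regular spreads *)

Lemma mem_fset3 (K : choiceType) (a b c x : K) :
  (x \in [fset a; b; c]%fset) = [|| x == a, x == b | x == c].
Proof. by rewrite !inE -orbA. Qed.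

Section Reguli.
Variables (F : finFieldType) (L : fieldExtType F).
Hypothesis dimL : \dim {:L} = 3%N.
Local Notation q := #|F|.
Local Notation frame := 'Hom((L * L)%type, 'rV[F]_6).
Implicit Types (Th : frame) (a b c d k x y : L).

Definition lincomb a b c d (p : L * L) : L * L :=
  (p.1 * a + p.2 * c, p.1 * b + p.2 * d).

Fact lincomb_is_linear a b c d : linear (lincomb a b c d).
Proof.
move=> r x y; rewrite /lincomb /= !mulrDl -!scalerAl.
by congr (_, _); rewrite /= scalerDr addrACA.
Qed.

HB.instance Definition _ a b c d :=
  GRing.isLinear.Build F (L * L)%type (L * L)%type _ (lincomb a b c d)
    (lincomb_is_linear a b c d).

(** Change of frame by a matrix of GL(2, L); it acts on the planes as the
projective line over L. *)
Definition reframe Th a b c d : frame := (Th \o linfun (lincomb a b c d))%VF.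

Lemma reframeE Th a b c d x y :
  reframe Th a b c d (x, y) = Th (x * a + y * c, x * b + y * d).
Proof. by rewrite comp_lfunE lfunE. Qed.

Lemma lker_comp0 Th (f : {linear (L * L)%type -> (L * L)%type}) :
  lker Th == 0%VS -> injective f -> lker (Th \o linfun f)%VF == 0%VS.
Proof.
move=> Th0 fI; apply/lker0P => u v; rewrite !comp_lfunE !lfunE /=.
by move/(lker0P Th0)/fI.
Qed.

Lemma reframe0 Th a b c d :
  lker Th == 0%VS -> a * d != b * c -> lker (reframe Th a b c d) == 0%VS.
Proof.
move=> Th0; rewrite -subr_eq0 => det; apply: lker_comp0 => // -[x y] [x' y'].
case=> /= e1 e2; congr (_, _); apply/eqP; rewrite -subr_eq0 -(mulIr_eq0 _ (mulIf det)).
  have -> : (x - x') * (a * d - b * c) =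
    (x * a + y * c - (x' * a + y' * c)) * d - (x * b + y * d - (x' * b + y' * d)) * c.
    by ring.
  by rewrite e1 e2 !subrr !mul0r subrr.
have -> : (y - y') * (a * d - b * c) =
    (x * b + y * d - (x' * b + y' * d)) * a - (x * a + y * c - (x' * a + y' * c)) * b.
  by ring.
by rewrite e1 e2 !subrr !mul0r subrr.
Qed.

Lemma plane_reframe Th a b c d s t :
  plane (reframe Th a b c d) s t = plane Th (s * a + t * c) (s * b + t * d).
Proof.
apply: eq_plane => x; exists x; rewrite reframeE; congr (Th (_, _)); ring.
Qed.

Lemma card_line_spread Th :
  lker Th == 0%VS -> #|` line_spread Th|%fset = (q ^ 3 + 1)%N.
Proof.
move=> Th0; have [cardD _] := plane_set_pencil dimL Th0 (uniq_all_scalars L).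
by rewrite -(size_all_scalars dimL).
Qed.

(** GL(2, L) permutes the points of PG(1, L), so all frames related by it have
the same spread. *)
Lemma line_spread_reframe Th a b c d :
  lker Th == 0%VS -> a * d != b * c ->
  line_spread (reframe Th a b c d) = line_spread Th.
Proof.
move=> Th0 det; have Th0' := reframe0 Th0 det.
have sub P : P \in line_spread (reframe Th a b c d) -> P \in line_spread Th.
  case/line_spreadP => s [t [st ->]]; apply/line_spreadP.
  exists (s * a + t * c), (s * b + t * d); rewrite plane_reframe; split=> //.
  apply: contraNneq st => -[e1 e2]; have := dim_plane dimL Th0'.
  move=> /(_ s t); case: eqVneq => // _ /(_ isT).
  rewrite plane_reframe e1 e2 => dm; have : \dim (plane Th 0 0) = 0%N.
    apply/eqP; rewrite dimv_eq0 -subv0; apply/subvP=> v /planeP[x ->].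
    by rewrite !mul0r linear0 mem0v.
  by rewrite dm.
apply/eqP; rewrite eqEfcard; apply/andP; split; first exact/fsubsetP.
by rewrite [leqLHS](card_line_spread Th0) [leqRHS](card_line_spread Th0').
Qed.

Lemma frameZ Th (r : F) x y : Th (r%:A * x, r%:A * y) = r *: Th (x, y).
Proof. by rewrite -linearZ /= !mulr_algl. Qed.

Lemma frame_neq0 Th x y : lker Th == 0%VS -> (x, y) != (0, 0) -> Th (x, y) != 0.
Proof. by move=> Th0; apply: contraNneq => /(frame_eq0 Th0)[-> ->]. Qed.

Lemma meets_planeP Th (l : subsp F 6) a b :
  meets l (plane Th a b) <->
  exists x, Th (a * x, b * x) != 0 /\ Th (a * x, b * x) \in l.
Proof.
rewrite meetsP; split=> [[v [v0 vl /planeP[x e]]]|[x [x0 xl]]].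
  by exists x; rewrite -e.
by exists (Th (a * x, b * x)); split=> //; apply/planeP; exists x.
Qed.

Lemma free2_disjoint (U V : subsp F 6) u v :
  disjointv U V -> u \in U -> v \in V -> u != 0 -> v != 0 -> free [:: u; v].
Proof.
move=> UV uU vV u0 v0; rewrite free_cons seq1_free v0 andbT span_seq1.
apply: contra u0 => /vlineP[r e]; apply/eqP/(disjointvP UV uU).
by rewrite e memvZ.
Qed.

Local Notation emb := (in_alg L).

(** If the line meets three planes of slopes (s_i : t_i) in the points of
parameters x_i, the relation between these points makes x1 and x2 multiples
of x3 by elements of F; then x3 is also the parameter of a point of the line
on every other plane of the pencil. *)
Lemma subline_regulus_line Th (l P1 P2 P3 : subsp F 6) :
    lker Th == 0%VS -> is_line l ->
    P1 \in subline_regulus Th -> P2 \in subline_regulus Th ->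
    P3 \in subline_regulus Th -> uniq [:: P1; P2; P3] ->
    meets l P1 -> meets l P2 -> meets l P3 ->
  forall P, P \in subline_regulus Th -> meets l P.
Proof.
move=> Th0 dl R1 R2 R3 uP m1 m2 m3 P /subline_regulusP [s [t [st ->]]].
have algF : injective (in_alg L) by apply: fmorph_inj.
have disj Q Q' := mutually_disjoint_pencil Th0 (K := base_scalars L) (U := Q) (V := Q').
move: uP; rewrite /= !inE !negb_or andbT => /andP[/andP[/eqP n12 /eqP n13] /eqP n23].
have {}n12 := disj _ _ R1 R2 n12; have {}n23 := disj _ _ R2 R3 n23.
have {}n13 := disj _ _ R1 R3 n13.
case/subline_regulusP: R1 n12 n13 m1 => s1 [t1 [st1 ->]].
case/subline_regulusP: R2 n23 m2 => s2 [t2 [st2 ->]].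
case/subline_regulusP: R3 m3 => s3 [t3 [st3 ->]].
move=> /meets_planeP[x3 [x30 x3l]] n23 /meets_planeP[x2 [x20 x2l]] n12 n13.
move=> /meets_planeP[x1 [x10 x1l]].
have mem u v x : Th (u * x, v * x) \in plane Th u v by apply/planeP; exists x.
have fr := free2_disjoint n12 (mem _ _ _) (mem _ _ _) x10 x20.
have [r1 [r2 e3]] := line_span dl x1l x2l x3l fr.
have r10 : r1 != 0.
  apply: contraNneq x30 => r10; apply/eqP/(disjointvP n23 _ (mem _ _ _)).
  by rewrite e3 r10 scale0r add0r memvZ.
have r20 : r2 != 0.
  apply: contraNneq x30 => r20; apply/eqP/(disjointvP n13 _ (mem _ _ _)).
  by rewrite e3 r20 scale0r addr0 memvZ.
pose D (s t s' t' : F) := s * t' - t * s'.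
have iD s' t' s'' t'' :
    emb (D s' t' s'' t'') = emb s' * emb t'' - emb t' * emb s''.
  by rewrite rmorphB !rmorphM.
have D120 : D s1 t1 s2 t2 != 0.
  apply: contraNneq x10 => D0; apply/eqP/(disjointvP n12 (mem _ _ _)).
  have pair0 (u v : F) : (u, v) != (0, 0) -> (emb u, emb v) != (0, 0).
    by rewrite !xpair_eqE !fmorph_eq0.
  rewrite -(plane_eq Th (pair0 _ _ st1) (pair0 _ _ st2)) ?mem //.
  by apply/eqP; rewrite -subr_eq0 -iD D0 rmorph0.
have x1N0 : x1 != 0.
  by apply: contraNneq x10 => ->; rewrite !mulr0 linear0.
have x2N0 : x2 != 0.
  by apply: contraNneq x20 => ->; rewrite !mulr0 linear0.
move: e3; rewrite -!frameZ -linearD => /(lker0P Th0) -[].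
rewrite -!/(emb _) => es et.
have e1 : emb (D s3 t3 s2 t2) * x3 = emb r1 * emb (D s1 t1 s2 t2) * x1.
  rewrite !iD mulrBl (mulrAC (emb s3)) (mulrAC (emb t3)) es et; ring.
have e2 : emb (D s1 t1 s3 t3) * x3 = emb r2 * emb (D s1 t1 s2 t2) * x2.
  rewrite !iD mulrBl -(mulrA (emb s1)) -(mulrA (emb t1)) es et; ring.
have D320 : D s3 t3 s2 t2 != 0.
  apply: contraTneq D120 => D0; move/eqP: e1; rewrite D0 rmorph0 mul0r eq_sym.
  by rewrite !mulf_eq0 !fmorph_eq0 (negPf r10) (negPf x1N0) orbF negbK.
have D130 : D s1 t1 s3 t3 != 0.
  apply: contraTneq D120 => D0; move/eqP: e2; rewrite D0 rmorph0 mul0r eq_sym.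
  by rewrite !mulf_eq0 !fmorph_eq0 (negPf r20) (negPf x2N0) orbF negbK.
pose al := D s t s2 t2 * r1 / D s3 t3 s2 t2.
pose be := D s1 t1 s t * r2 / D s1 t1 s3 t3.
have x3E1 : x3 = emb r1 * emb (D s1 t1 s2 t2) * x1 / emb (D s3 t3 s2 t2).
  by rewrite -e1 mulrC mulKf ?fmorph_eq0.
have x3E2 : x3 = emb r2 * emb (D s1 t1 s2 t2) * x2 / emb (D s1 t1 s3 t3).
  by rewrite -e2 mulrC mulKf ?fmorph_eq0.
have x3N0 : x3 != 0.
  by apply: contraNneq x30 => ->; rewrite !mulr0 linear0.
(* Cramer: D12 (s, t) = D(p, 2) (s1, t1) + D(1, p) (s2, t2), p = (s, t). *)
have key S1 S2 S : emb (D s1 t1 s2 t2) * emb S =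
    emb (D s t s2 t2) * emb S1 + emb (D s1 t1 s t) * emb S2 ->
    emb S * x3 = emb al * (emb S1 * x1) + emb be * (emb S2 * x2).
  move=> eS; have a1 : emb al * x1 = emb (D s t s2 t2) * x3 / emb (D s1 t1 s2 t2).
    rewrite [in RHS]x3E1 fmorph_div rmorphM; field.
    by rewrite !fmorph_eq0 D120.
  have b1 : emb be * x2 = emb (D s1 t1 s t) * x3 / emb (D s1 t1 s2 t2).
    rewrite [in RHS]x3E2 fmorph_div rmorphM; field.
    by rewrite !fmorph_eq0 D120.
  rewrite !(mulrCA _ (emb S1)) !(mulrCA _ (emb S2)) a1 b1.
  have D12N0 : emb (D s1 t1 s2 t2) != 0 by rewrite fmorph_eq0.
  apply: (mulfI D12N0); rewrite mulrA eS mulrDr mulrDl; field.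
  exact: D12N0.
apply/meets_planeP; exists x3.
have e : Th (s%:A * x3, t%:A * x3) =
          al *: Th (s1%:A * x1, t1%:A * x1) + be *: Th (s2%:A * x2, t2%:A * x2).
  rewrite -!frameZ -linearD; congr (Th (_, _)).
    by apply: key; rewrite !iD; ring.
  by apply: key; rewrite !iD; ring.
split; last by rewrite e memvD ?memvZ.
apply: frame_neq0 => //; rewrite xpair_eqE !mulf_eq0 (negPf x3N0).
by rewrite !orbF !fmorph_eq0 -xpair_eqE.
Qed.

Lemma subline_regulus_is_regulus Th :
  lker Th == 0%VS -> is_regulus (subline_regulus Th).
Proof.
move=> Th0; split.
- have := plane_set_pencil dimL Th0 (uniq_base_scalars L).
  by rewrite size_map -cardE.
- exact: mutually_disjoint_pencil.
by move=> l P1 P2 P3 dl R1 R2 R3; apply: subline_regulus_line.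
Qed.

(** Let P be another plane of the regulus. The line joining Th (x, 0) and
Th (0, x) meets the first three planes, so it meets P, which therefore
contains some Th (x, t x) with t in F. As P is the graph of an F-linear map
for which every vector is an eigenvector, t does not depend on x. *)
Lemma regulus_unique Th (R : {fset subsp F 6}) :
    lker Th == 0%VS -> is_regulus R ->
    plane Th 1 0 \in R -> plane Th 0 1 \in R -> plane Th 1 1 \in R ->
  R = subline_regulus Th.
Proof.
move=> Th0 [[cardR planeR] disjR lineR] R10 R01 R11.
have meet_slope P : P \in R -> P <> plane Th 0 1 ->
    forall x, exists t : F, Th (x, t *: x) \in P.
  move=> RP nP x; have [->|x0] := eqVneq x 0.
    by exists 0; rewrite scaler0 linear0 mem0v.
  have ThN0 u v : (u, v) != (0, 0) -> Th (u, v) != 0.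
    exact: frame_neq0.
  have fr : free [:: Th (x, 0); Th (0, x)].
    apply: (@free2_disjoint (plane Th 1 0) (plane Th 0 1)).
    - by apply: plane_disjoint; rewrite ?mul1r ?mul0r ?oner_eq0.
    - by apply/planeP; exists x; rewrite mul1r mul0r.
    - by apply/planeP; exists x; rewrite mul1r mul0r.
    - by apply: ThN0; rewrite xpair_eqE negb_and x0.
    by apply: ThN0; rewrite xpair_eqE negb_and x0 orbT.
  pose l := span [:: Th (x, 0); Th (0, x)].
  have dl : is_line l by rewrite /is_line (eqP fr).
  have lx0 : Th (x, 0) \in l by apply: memv_span; rewrite inE eqxx.
  have l0x : Th (0, x) \in l by apply: memv_span; rewrite !inE eqxx orbT.
  have ml : meets l P.
    apply: (lineR l (plane Th 1 0) (plane Th 0 1) (plane Th 1 1)) => //.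
    - rewrite /= !inE !negb_or !andbT; apply/andP; split; first (apply/andP; split).
      + apply/eqP=> /(plane_inj dimL Th0 (pair10 0))/eqP.
        by rewrite mulr1 mul0r oner_eq0.
      + by apply/eqP=> /(plane1_inj dimL Th0)/eqP; rewrite eq_sym oner_eq0.
      apply/eqP=> /(plane_inj dimL Th0 (pair01 L))/eqP.
      by rewrite !mulr1 eq_sym oner_eq0.
    - apply/meets_planeP; exists x; rewrite mul1r mul0r; split=> //.
      by apply: ThN0; rewrite xpair_eqE negb_and x0.
    - apply/meets_planeP; exists x; rewrite mul1r mul0r; split=> //.
      by apply: ThN0; rewrite xpair_eqE negb_and x0 orbT.
    apply/meets_planeP; exists x; rewrite mul1r; split=> //.
      by apply: ThN0; rewrite xpair_eqE negb_and x0.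
    have -> : (x, x) = (x, 0) + (0, x) :> L * L.
      by congr (_, _); rewrite /= ?addr0 ?add0r.
    by rewrite linearD memvD.
  case/meetsP: ml => v [v0 vl vP].
  have [r [s e]] := line_span dl lx0 l0x vl fr.
  have {}e : v = Th (r *: x, s *: x).
    rewrite e -!linearZ -linearD; congr (Th (_, _)).
      by rewrite /= scaler0 addr0.
    by rewrite /= scaler0 add0r.
  have r0 : r != 0.
    apply: contraNneq v0 => r0.
    apply/eqP/(disjointvP (disjR _ _ RP R01 nP) vP); apply/planeP.
    by exists (s *: x); rewrite e r0 scale0r mul0r mul1r.
  exists (s / r); have -> : (x, (s / r) *: x) = r^-1 *: (r *: x, s *: x).
    by congr (_, _); rewrite /= scalerA ?mulVf ?scale1r // mulrC.
  by rewrite linearZ /= memvZ // -e.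
apply/eqP; rewrite eqEfcard; apply/andP; split; last first.
  have [[-> _] _ _] := subline_regulus_is_regulus Th0; by rewrite cardR.
apply/fsubsetP=> P RP; apply/pencilP.
have [->|/eqP nP] := eqVneq P (plane Th 0 1); [by left | right].
have slope := meet_slope P RP nP.
have vert y : Th (0, y) \in P -> y = 0.
  move=> yP; have : Th (0, y) = 0.
    apply: (disjointvP (disjR _ _ RP R01 nP) yP); apply/planeP.
    by exists y; rewrite mul0r mul1r.
  by move/(frame_eq0 Th0) => -[].
have slope_uniq x y y' : Th (x, y) \in P -> Th (x, y') \in P -> y = y'.
  move=> yP y'P; apply/eqP; rewrite -subr_eq0; apply/eqP/vert.
  have -> : (0, y - y') = (x, y) - (x, y') :> L * L.
    by congr (_, _); rewrite /= subrr.
  by rewrite linearB memvB.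
have [t1 t1P] := slope 1.
(* The eigenvalue at 1 + x compares those at 1 and x, unless x lies in F. *)
have eP : forall x, Th (x, t1 *: x) \in P.
  move=> x; have [/vlineP[c ->]|x1] := boolP (x \in 1%VS).
    have -> : (c%:A, t1 *: c%:A) = c *: (1, t1%:A) :> L * L.
      by congr (_, _); rewrite /= !scalerA mulrC.
    by rewrite linearZ memvZ.
  have [t tP] := slope x; have [t' t'P] := slope (1 + x).
  have := slope_uniq _ _ (t1 *: 1 + t *: x) t'P.
  have -> : (1 + x, t1 *: 1 + t *: x) = (1, t1 *: 1) + (x, t *: x) :> L * L by [].
  rewrite linearD memvD // => /(_ isT)/eqP.
  rewrite scalerDr -subr_eq0 opprD addrACA -!scalerBl addr_eq0 -scaleNr opprB.
  have [tt|tt /eqP e] := eqVneq t t'.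
    rewrite tt subrr scale0r -(scale0r 1) -subr_eq0 -scalerBl subr0.
    rewrite scaler_eq0 oner_eq0 orbF subr_eq0 => /eqP <-.
    by rewrite -tt.
  case/negP: x1; apply/vlineP; exists ((t - t')^-1 * (t' - t1)).
  by rewrite -scalerA e scalerA mulVf ?scale1r // subr_eq0.
exists t1%:A; first by apply/mem_base_scalars; exists t1.
apply/esym/eqP; rewrite eqEdim (planeR _ RP) (dim_plane dimL Th0) ?pair10 // andbT.
by apply/subvP=> v /planeP[x ->]; rewrite mul1r mulr_algl.
Qed.

(** Rescaling two of the three given planes by the determinants of Cramer's rule
makes the third one the plane of slope 1 of a new frame. *)
Lemma line_spread_regular Th : lker Th == 0%VS -> is_regular_spread (line_spread Th).
Proof.
move=> Th0; have := plane_set_pencil dimL Th0 (uniq_all_scalars L).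
rewrite (size_all_scalars dimL) => sp; split.
  split=> //; first exact: mutually_disjoint_pencil.
  move=> X dX; have [v v0 XE] : exists2 v, v != 0 & X = <[v]>%VS.
    have X0 : X != 0%VS by rewrite -dimv_eq0 dX.
    exists (vpick X); first by rewrite vpick0.
    by apply/esym/eqP; rewrite eqEdim -memvE memv_pick dim_vline vpick0 X0 dX.
  have [x [y e]] := frame_surj dimL Th0 v.
  have xy : (x, y) != (0, 0) by apply: contraNneq v0; rewrite e => ->; rewrite linear0.
  exists (plane Th x y); first by apply/line_spreadP; exists x, y.
  by rewrite XE e -memvE; apply/planeP; exists 1; rewrite !mulr1.
move=> P1 P2 P3 /line_spreadP[a1 [b1 [ab1 ->]]] /line_spreadP[a2 [b2 [ab2 ->]]].
case/line_spreadP=> a3 [b3 [ab3 ->]].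
rewrite /= !inE !negb_or andbT => /andP[/andP[n12 n13] n23].
pose D12 := a1 * b2 - b1 * a2; pose D32 := a3 * b2 - b3 * a2.
pose D13 := a1 * b3 - b1 * a3.
have D120 : D12 != 0.
  by apply: contraNneq n12 => /subr0_eq e; apply/eqP/plane_eq.
have D130 : D13 != 0.
  by apply: contraNneq n13 => /subr0_eq e; apply/eqP/plane_eq.
have D320 : D32 != 0.
  apply: contraNneq n23 => /subr0_eq e; apply/eqP/plane_eq => //.
  by rewrite mulrC -e mulrC.
have det : (a1 * D32) * (b2 * D13) != (b1 * D32) * (a2 * D13).
  rewrite -subr_eq0; have -> : a1 * D32 * (b2 * D13) - b1 * D32 * (a2 * D13) = D12 * D32 * D13.
    by rewrite /D12; ring.
  by rewrite !mulf_neq0.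
pose Th' := reframe Th (a1 * D32) (b1 * D32) (a2 * D13) (b2 * D13).
have Th0' : lker Th' == 0%VS by apply: reframe0.
exists (subline_regulus Th'); split.
- exact: subline_regulus_is_regulus.
- apply/fsubsetP=> P; rewrite mem_fset3 => /or3P[] /eqP ->; apply/pencilP.
  + right; exists 0; first by apply/mem_base_scalars; exists 0; rewrite scale0r.
    by rewrite plane_reframe !mul1r !mul0r !addr0 plane_scale.
  + by left; rewrite plane_reframe !mul1r !mul0r !add0r plane_scale.
  right; exists 1; first by apply/mem_base_scalars; exists 1; rewrite scale1r.
  rewrite plane_reframe !mul1r.
  have -> : a1 * D32 + a2 * D13 = a3 * D12 by rewrite /D32 /D13 /D12; ring.
  have -> : b1 * D32 + b2 * D13 = b3 * D12 by rewrite /D32 /D13 /D12; ring.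
  by rewrite plane_scale.
rewrite -(line_spread_reframe Th0 det).
apply/fsubsetP=> P /pencilP[->|[k _ ->]]; apply/pencilP; first by left.
by right; exists k; first exact: mem_all_scalars.
Qed.

End Reguli.

(** * Uniqueness of the regular spread *)

Section SpreadUniqueness.
Variables (F : finFieldType) (L : fieldExtType F).
Hypothesis dimL : \dim {:L} = 3%N.
Variable tau : L.
Hypothesis tau_prim : (#|F| ^ 3 - 1)%N.-primitive_root tau.
Local Notation q := #|F|.
Local Notation n := (#|F| ^ 2 + #|F| + 1)%N.
Local Notation zeta := (zeta tau).

(** Translated to the origin, a set closed under lines over a field with an
element s other than 0 and 1 is a subspace: (b + c) lies on the line joining
b / (1 - s) and c / s. A subspace of L with more than q^2 elements is L. *)
Lemma affine_span (A : {pred L}) (X : seq L) :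
    (2 < q)%N -> uniq X -> {subset X <= A} -> (q ^ 2 < size X)%N ->
    (forall u v (t : F), u \in A -> v \in A -> u + t *: (v - u) \in A) ->
  forall u, u \in A.
Proof.
move=> q2; case: X => [|a X] // uX sX sizeX lineA.
have aA : a \in A by apply: sX; rewrite inE eqxx.
pose B := [pred b | a + b \in A].
have B0 : 0 \in B by rewrite inE addr0.
have BZ (t : F) b : b \in B -> t *: b \in B.
  rewrite !inE => bB; have -> : a + t *: b = a + t *: (a + b - a).
    by rewrite (addrC a b) addrK.
  exact: lineA.
have [s s0 s1] : exists2 s : F, s != 0 & s != 1.
  have [s /andP[] |no] := pickP [pred s : F | (s != 0) && (s != 1)]; first by exists s.
  suff : (q <= size [:: 0%R : F; 1%R])%N by rewrite leqNgt q2.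
  rewrite cardE; apply: uniq_leq_size; first exact: enum_uniq.
  by move=> s _; have /negbT := no s; rewrite /= negb_and !negbK !inE.
have BD b c : b \in B -> c \in B -> b + c \in B.
  move=> bB cB; pose b' := (1 - s)^-1 *: b; pose c' := s^-1 *: c.
  have bE : b = b' - s *: b'.
    by rewrite -{1}(scale1r b') -scalerBl scalerA mulfV ?scale1r // subr_eq0 eq_sym.
  have cE : c = s *: c' by rewrite scalerA mulfV ?scale1r.
  rewrite inE; have := lineA _ _ s (BZ (1 - s)^-1 _ bB) (BZ s^-1 _ cB).
  congr (_ \in A); rewrite -/b' -/c' {1}bE {1}cE opprD addrACA subrr add0r.
  by rewrite scalerBr -!addrA; congr (_ + (_ + _)); rewrite addrC.
pose U := span [seq x - a | x <- a :: X].
have UB : {subset U <= B}.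
  move=> u uU; rewrite (@coord_span _ _ _ (in_tuple [seq x - a | x <- a :: X]) u uU).
  elim/big_ind: _ => // i _; apply: BZ.
  have /mapP[x xX ->] : (in_tuple [seq x - a | x <- a :: X])`_i \in [seq x - a | x <- a :: X].
    exact: mem_nth.
  by rewrite inE addrC subrK sX.
suff UE : U = fullv.
  by move=> u; have := UB (u - a); rewrite UE memvf inE addrC subrK; apply.
apply/eqP; rewrite eqEdim subvf dimL /= leqNgt ltnS; apply/negP => dimU.
have : (size (a :: X) <= q ^ \dim U)%N.
  rewrite -(@card_vspace F (finvect_type L)) cardE.
  rewrite -(size_map (fun x => x - a)); apply: uniq_leq_size.
    by rewrite map_inj_uniq //; apply: addIr.
  by move=> u uX'; rewrite (@mem_enum (finvect_type L)); apply: memv_span.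
apply/negP; rewrite -ltnNge (leq_trans _ sizeX) // ltnS leq_exp2l //.
exact: card_gt1.
Qed.

Variable Th : 'Hom((L * L)%type, 'rV[F]_6).
Hypothesis Th0 : lker Th == 0%VS.
Variable T : {fset subsp F 6}.
Hypothesis TP :
  forall P, P \in T <-> exists k : L, k ^+ n = 1 /\ P = plane Th 1 k.

(** The frame Th' sends the plane y = x to infinity. The other norm-1 planes,
y = k x, get the slopes 1 / (k - 1). *)
Lemma regular_spread_unique R :
  is_regular_spread R -> (T `<=` R)%fset -> R = line_spread Th.
Proof.
case=> -[[cardR planeR] disjR coverR] regR TR.
have TRk k : k ^+ n = 1 -> plane Th 1 k \in R.
  by move=> kn; apply: (fsubsetP TR); apply/TP; exists k.
have cardS := card_line_spread dimL Th0.
have [q2|q2] := ltnP 2 q.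
  have det : 0 * 1 != 1 * 1 :> L by rewrite !mulr1 eq_sym oner_eq0.
  pose Th' := reframe Th 0 1 1 1.
  have Th0' : lker Th' == 0%VS by apply: reframe0.
  have E1 u : plane Th' 1 u = plane Th u (1 + u).
    by rewrite plane_reframe !mul1r !mulr1 add0r.
  have Rinf : plane Th' 0 1 \in R.
    by rewrite plane_reframe !mul0r !mul1r !add0r TRk ?expr1n.
  have RA : forall u, plane Th' 1 u \in R.
    pose X := [seq (zeta ^+ i - 1)^-1 | i <- iota 1 (n - 1)].
    have zeta1 i : i \in iota 1 (n - 1) -> zeta ^+ i - 1 != 0.
      rewrite mem_iota subr_eq0 => ?; apply: (zetaX_neq1 tau_prim); lia.
    apply: (affine_span (A := [pred u | plane Th' 1 u \in R]) (X := X)) => //.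
    - rewrite map_inj_in_uniq ?iota_uniq // => i j; rewrite !mem_iota => li lj.
      move/invr_inj/addIr/eqP; rewrite (eq_prim_root_expr (zeta_prim tau_prim)).
      by rewrite !modn_small; [move/eqP | lia | lia].
    - move=> u /mapP[i iI ->]; rewrite inE E1; set c := _^-1.
      have c0 : c != 0 by rewrite invr_eq0 zeta1.
      have -> : 1 + c = zeta ^+ i * c.
        by rewrite -[X in X + _](mulfV (zeta1 i iI)) -/c -[X in _ + X]mul1r -mulrDl subrK.
      rewrite -[X in plane _ X _]mul1r plane_scale // TRk //.
      by rewrite exprAC (prim_expr_order (zeta_prim tau_prim)) expr1n.
    - by rewrite size_map size_iota; have := card_gt1 F; lia.
    move=> u v t; rewrite !inE => uR vR.
    have [->|uv] := eqVneq v u; first by rewrite subrr scaler0 addr0.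
    have [|Rg [regRg sub1 sub2]] := regR _ _ _ Rinf uR vR.
      rewrite /= !inE !negb_or !andbT; apply/andP; split; last first.
        by apply: contra uv => /eqP/(plane1_inj dimL Th0') ->.
      apply/andP; split; apply/eqP=> /(plane_inj dimL Th0' (pair01 L))/eqP;
        by rewrite mul0r mulr1 eq_sym oner_eq0.
    have det' : 1 * (v - u) != u * 0 by rewrite mul1r mulr0 subr_eq0.
    pose Th2 := reframe Th' 1 u 0 (v - u).
    have Th02 : lker Th2 == 0%VS by apply: reframe0.
    have mem1 P : P \in [fset plane Th' 0 1; plane Th' 1 u; plane Th' 1 v]%fset -> P \in Rg.
      exact: (fsubsetP sub1).
    have RgE : Rg = subline_regulus Th2.
      apply: regulus_unique => //.
      - apply: mem1; rewrite plane_reframe !mul1r !mul0r !addr0.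
        by rewrite mem_fset3; apply/or3P; constructor 2.
      - apply: mem1; rewrite plane_reframe !mul1r !mul0r !add0r.
        rewrite -{1}(mul0r (v - u)) -{2}(mul1r (v - u)) plane_scale ?subr_eq0 //.
        by rewrite mem_fset3; apply/or3P; constructor 1.
      apply: mem1; rewrite plane_reframe !mul1r addr0 addrC subrK.
      by rewrite mem_fset3; apply/or3P; constructor 3.
    apply: (fsubsetP sub2); rewrite RgE; apply/pencilP; right.
    exists t%:A; first by apply/mem_base_scalars; exists t.
    by rewrite [RHS]plane_reframe !mul1r mulr0 addr0 mulr_algl.
  apply/esym/eqP; rewrite eqEfcard cardR cardS leqnn andbT.
  rewrite -(line_spread_reframe dimL Th0 det).
  by apply/fsubsetP=> P /pencilP[->|[k _ ->]].
(* q = 2: every nonzero element of L has norm 1. *)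
have {}q2 : q = 2%N by apply/eqP; rewrite eqn_leq q2 card_gt1.
apply/eqP; rewrite eqEfcard cardR cardS leqnn andbT; apply/fsubsetP=> P RP.
apply/line_spreadP; have [PT|PT] := boolP (P \in T).
  by have /TP[k [_ ->]] := PT; exists 1, k; rewrite pair10.
have axes x y : Th (x, y) \in P -> x = 0 \/ y = 0.
  move=> xyP; have [->|x0] := eqVneq x 0; first by left.
  have [->|y0] := eqVneq y 0; first by right.
  case/negP: PT; have kR : plane Th 1 (y / x) \in T.
    apply/TP; exists (y / x); split=> //.
    have yx : y / x != 0 by rewrite mulf_neq0 ?invr_eq0.
    apply: (mulfI yx); rewrite -exprS mulr1 q2 -[RHS](expq3 dimL); congr (_ ^+ _).
    by rewrite q2.
  suff -> : P = plane Th 1 (y / x) by [].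
  have [//|/eqP nP] := eqVneq P (plane Th 1 (y / x)).
  have /(frame_eq0 Th0)[x00 _] : Th (x, y) = 0.
    apply: (disjointvP (disjR _ _ RP (fsubsetP TR _ kR) nP) xyP).
    by apply/planeP; exists x; rewrite mul1r divfK.
  by rewrite x00 eqxx in x0.
have [Pv|/subvPn[v vP]] := boolP (P <= plane Th 0 1)%VS.
  exists 0, 1; rewrite pair01; split=> //; apply/eqP.
  by rewrite eqEdim Pv (dim_plane dimL Th0) ?pair01 // (planeR _ RP).
have [x [y e]] := frame_surj dimL Th0 v; rewrite e in vP *.
move=> /planeP nv; have x0 : x != 0.
  by apply: contra_notN nv => /eqP ->; exists y; rewrite mul0r mul1r.
have y0 : y = 0 by have [x00|//] := axes _ _ vP; rewrite x00 eqxx in x0.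
exists 1, 0; rewrite pair10; split=> //; apply/eqP.
rewrite eqEdim (dim_plane dimL Th0) ?pair10 // (planeR _ RP) andbT.
apply/subvP=> w wP; have [x' [y' e']] := frame_surj dimL Th0 w.
apply/planeP; exists x'; rewrite mul1r mul0r e'; congr (Th (_, _)).
rewrite e' in wP; have [x'0|//] := axes _ _ wP.
have [x00|//] : x = 0 \/ y' = 0; last by rewrite x00 eqxx in x0.
apply: axes; have -> : (x, y') = (x, y) + (x', y') :> L * L.
  by rewrite y0 x'0; congr (_, _); rewrite /= ?addr0 ?add0r.
by rewrite linearD memvD.
Qed.

End SpreadUniqueness.

(** * Extension of scalars and conjugation *)

Section Embedding.
Variables (F : finFieldType) (L : fieldExtType F) (m : nat).
Local Notation embed := (@embed F L m).
Implicit Types (U : subsp F m) (W : subsp L m) (v : 'rV[F]_m) (w : 'rV[L]_m).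

Lemma embedD u v : embed (u + v) = embed u + embed v.
Proof. exact: map_mxD. Qed.

Lemma embedZ (c : F) v : embed (c *: v) = c%:A *: embed v.
Proof. by apply/rowP => i; rewrite !mxE -[RHS]/(in_alg L c * in_alg L _) -rmorphM. Qed.

Lemma embed_delta i : embed (delta_mx 0 i) = delta_mx 0 i.
Proof. exact: map_delta_mx. Qed.

Lemma embed_sum I (r : seq I) (P : pred I) (f : I -> 'rV[F]_m) :
  embed (\sum_(i <- r | P i) f i) = \sum_(i <- r | P i) embed (f i).
Proof. exact: (big_morph _ embedD (map_mx0 _ _ _)). Qed.

Lemma mem_extend U v : v \in U -> embed v \in extend L U.
Proof.
move=> vU; rewrite (coord_vbasis vU) embed_sum; apply: memv_suml => i _.
by rewrite embedZ memvZ // memv_span // map_f // mem_nth // size_tuple.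
Qed.

(** The extension consists of the L-combinations of embedded vectors. *)
Lemma extend_ind U (Q : 'rV[L]_m -> Prop) :
    (forall v, v \in U -> Q (embed v)) -> Q 0 ->
    (forall u w, Q u -> Q w -> Q (u + w)) -> (forall c w, Q w -> Q (c *: w)) ->
  forall w, w \in extend L U -> Q w.
Proof.
move=> Qe Q0 QD QZ w wU.
rewrite (@coord_span _ _ _ (in_tuple [seq embed v | v <- vbasis U]) w wU).
elim/big_ind: _ => // i _; apply: QZ.
have /mapP[v vU ->] : (in_tuple [seq embed v | v <- vbasis U])`_i
    \in [seq embed v | v <- vbasis U] by exact: mem_nth.
by apply: Qe; apply: vbasis_mem.
Qed.

Definition conj_vec w := map_mx (@frobenius F L) w.

Lemma conj_vecD u w : conj_vec (u + w) = conj_vec u + conj_vec w.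
Proof. exact: map_mxD. Qed.

Lemma conj_vecZ c w : conj_vec (c *: w) = c ^+ #|F| *: conj_vec w.
Proof. by apply/rowP => i; rewrite !mxE rmorphM. Qed.

Lemma conj_vec_sum I (r : seq I) (P : pred I) (f : I -> 'rV[L]_m) :
  conj_vec (\sum_(i <- r | P i) f i) = \sum_(i <- r | P i) conj_vec (f i).
Proof. exact: (big_morph _ conj_vecD (map_mx0 _ _ _)). Qed.

Lemma conj_embed v : conj_vec (embed v) = embed v.
Proof. by apply/rowP => i; rewrite !mxE /frobenius -[#|F|]expn1 in_alg_expq. Qed.

(** Conjugation is semilinear, so membership can be tested on a basis. *)
Lemma mem_conjv W w : w \in W -> conj_vec w \in conjv W.
Proof.
move=> wW; rewrite (coord_vbasis wW) conj_vec_sum; apply: memv_suml => i _.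
rewrite conj_vecZ memvZ // memv_span //.
by apply: (map_f conj_vec); rewrite mem_nth // size_tuple.
Qed.

Lemma conjv_sub W W' :
  (forall w, w \in W -> conj_vec w \in W') -> (conjv W <= W')%VS.
Proof.
by move=> sub; apply/span_subvP => _ /mapP[w wW ->]; apply/sub/vbasis_mem.
Qed.

End Embedding.

Lemma line_basis (K : fieldType) m (h : subsp K m) :
  is_line h -> exists u v, [/\ u \in h, v \in h & free [:: u; v]].
Proof.
move=> dh; have : size (vbasis h) = 2%N by rewrite size_tuple dh.
have := basis_free (vbasisP h).
have : {subset tval (vbasis h) <= h} by move=> u; apply: vbasis_mem.
case: (tval (vbasis h)) => [|u [|v []]] // mem fr _; exists u, v.
by split=> //; apply: mem; rewrite !inE eqxx ?orbT.
Qed.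

(** * Transversal lines of the norm-1 planes *)

Section Transversals.
Variables (F : finFieldType) (L : fieldExtType F).
Hypothesis dimL : \dim {:L} = 3%N.
Variable tau : L.
Hypothesis tau_prim : (#|F| ^ 3 - 1)%N.-primitive_root tau.
Local Notation q := #|F|.
Local Notation n := (#|F| ^ 2 + #|F| + 1)%N.
Local Notation zeta := (zeta tau).
Variable Th : 'Hom((L * L)%type, 'rV[F]_6).
Hypothesis Th0 : lker Th == 0%VS.
Local Notation embed := (@embed F L 6).

Let psi1 (x : L) := embed (Th (x, 0)).
Let psi2 (x : L) := embed (Th (0, x)).
(** The vectors dual to the coordinates X_i described at the top; [axis2] gives
those dual to Y_i. *)
Definition axis1 := qcoef tau psi1.
Definition axis2 := qcoef tau psi2.
Definition axis1_mx : 'M[L]_(3, 6) := \matrix_(i < 3) axis1 i.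
Definition axis2_mx : 'M[L]_(3, 6) := \matrix_(i < 3) axis2 i.
(** The vector with coordinates a = (X_i) and b = (Y_i). *)
Definition axis_comb (a b : 'rV[L]_3) : 'rV[L]_6 := a *m axis1_mx + b *m axis2_mx.
Definition conjugates (x : L) : 'rV[L]_3 := \row_i x ^+ (q ^ i).

Lemma axis_combE a b :
  axis_comb a b = \sum_(i < 3) a 0 i *: axis1 i + \sum_(i < 3) b 0 i *: axis2 i.
Proof.
rewrite /axis_comb !mulmx_sum_row; congr (_ + _); apply: eq_bigr => i _;
 by rewrite rowK.
Qed.

(** The coordinates of a point of PG(5,q) are conjugate over F. *)
Lemma embed_frame x y : embed (Th (x, y)) = axis_comb (conjugates x) (conjugates y).
Proof.
have -> : (x, y) = (x, 0) + (0, y) :> L * L.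
  by congr (_, _); rewrite /= ?addr0 ?add0r.
rewrite linearD /= embedD axis_combE; congr (_ + _).
  rewrite -/(psi1 x) (linear_expansion dimL tau_prim (phi := psi1)).
    by apply: eq_bigr => i _; rewrite mxE.
  move=> c u v; rewrite /psi1 -embedZ -embedD -linearZ -linearD.
  by congr (embed (Th (_, _))); rewrite /= scaler0 addr0.
rewrite -/(psi2 y) (linear_expansion dimL tau_prim (phi := psi2)).
  by apply: eq_bigr => i _; rewrite mxE.
move=> c u v; rewrite /psi2 -embedZ -embedD -linearZ -linearD.
by congr (embed (Th (_, _))); rewrite /= scaler0 addr0.
Qed.

Lemma axis_comb_row_mx a b : axis_comb a b = row_mx a b *m col_mx axis1_mx axis2_mx.
Proof. by rewrite mul_row_col. Qed.

(** Embedded vectors are combinations of the six axis vectors, and they span. *)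
Lemma axis_full : row_full (col_mx axis1_mx axis2_mx).
Proof.
rewrite -sub1mx; apply/row_subP => i; rewrite row1 -embed_delta.
have [x [y ->]] := frame_surj dimL Th0 (delta_mx 0 i).
by rewrite embed_frame axis_comb_row_mx submxMl.
Qed.

Lemma axis_comb_surj w : exists a b, w = axis_comb a b.
Proof.
have /submxP[r ->] := submx_full w axis_full.
by exists (lsubmx r), (rsubmx r); rewrite axis_comb_row_mx hsubmxK.
Qed.

Lemma axis_comb_inj a b a' b' : axis_comb a b = axis_comb a' b' -> a = a' /\ b = b'.
Proof.
rewrite !axis_comb_row_mx => /(row_free_inj _) e.
have fr : row_free (col_mx axis1_mx axis2_mx) by rewrite /row_free (eqP axis_full).
by have /eq_row_mx := e fr.
Qed.

Lemma axis_combD a b a' b' : axis_comb a b + axis_comb a' b' = axis_comb (a + a') (b + b').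
Proof. by rewrite /axis_comb !mulmxDl addrACA. Qed.

Lemma axis_combZ c a b : c *: axis_comb a b = axis_comb (c *: a) (c *: b).
Proof. by rewrite /axis_comb scalerDr !scalemxAl. Qed.

Lemma axis_comb0 : axis_comb 0 0 = 0.
Proof. by rewrite /axis_comb !mul0mx addr0. Qed.

Lemma axis_comb_delta1 (i : 'I_3) : axis_comb (delta_mx 0 i) 0 = axis1 i.
Proof. by rewrite /axis_comb mul0mx addr0 -rowE rowK. Qed.

Lemma axis_comb_delta2 (i : 'I_3) : axis_comb 0 (delta_mx 0 i) = axis2 i.
Proof. by rewrite /axis_comb mul0mx add0r -rowE rowK. Qed.

Lemma mem_extend_plane k a b :
  axis_comb a b \in extend L (plane Th 1 k) ->
  forall i : 'I_3, b 0 i = k ^+ (q ^ i) * a 0 i.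
Proof.
pose Q w := exists a b, w = axis_comb a b /\ forall i : 'I_3, b 0 i = k ^+ (q ^ i) * a 0 i.
move=> wP; suff [a' [b' [/axis_comb_inj [-> ->]]]] : Q (axis_comb a b) by [].
apply: extend_ind wP => [v /planeP[x ->]||u v [c [d [-> e]]] [c' [d' [-> e']]]|].
- exists (conjugates (1 * x)), (conjugates (k * x)); rewrite embed_frame.
  by split=> // i; rewrite !mxE exprMn mul1r.
- by exists 0, 0; rewrite axis_comb0; split=> // i; rewrite !mxE mulr0.
- exists (c + c'), (d + d'); rewrite axis_combD; split=> // i.
  by rewrite !mxE e e' mulrDr.
move=> c _ [a' [b' [-> e]]]; exists (c *: a'), (c *: b'); rewrite axis_combZ; split=> // i.
by rewrite !mxE e mulrCA.
Qed.

Definition axis_line i : subsp L 6 := span [:: axis1 i; axis2 i].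

Lemma mem_axis_line (i : 'I_3) a b :
  axis_comb a b \in axis_line i <-> forall j, j != i -> a 0 j = 0 /\ b 0 j = 0.
Proof.
split.
  rewrite /axis_line span_cons span_seq1 => /memv_addP[_ /vlineP[r ->]].
  case=> _ /vlineP[s ->]; rewrite -axis_comb_delta1 -axis_comb_delta2 !axis_combZ axis_combD.
  rewrite !scaler0 addr0 add0r => /axis_comb_inj [-> ->] j ji.
  by rewrite !mxE eqxx (negPf ji) !mulr0.
move=> off; have -> : axis_comb a b = a 0 i *: axis1 i + b 0 i *: axis2 i.
  rewrite axis_combE (bigD1 i) //= big1 ?addr0 => [|j /off[-> _]]; last by rewrite scale0r.
  rewrite (bigD1 i) //= big1 ?addr0 // => j /off[_ ->]; by rewrite scale0r.
by rewrite memvD ?memvZ ?memv_span // !inE eqxx ?orbT.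
Qed.

Lemma axis_free (i : 'I_3) : free [:: axis1 i; axis2 i].
Proof.
rewrite free_cons span_seq1 seq1_free; apply/andP; split; last first.
  apply/eqP; rewrite -axis_comb_delta2 -axis_comb0 => /axis_comb_inj[_ /rowP/(_ i)].
  by rewrite !mxE !eqxx => /eqP; rewrite oner_eq0.
apply/vlineP => -[r]; rewrite -axis_comb_delta1 -axis_comb_delta2 axis_combZ.
move=> /axis_comb_inj[/rowP/(_ i)].
by rewrite !mxE !eqxx mulr0 => /eqP; rewrite oner_eq0.
Qed.

Lemma axis_line_is_line (i : 'I_3) : is_line (axis_line i).
Proof. by rewrite /is_line (eqP (axis_free i)). Qed.

Lemma axis_line_inj (i j : 'I_3) : axis_line i = axis_line j -> i = j.
Proof.
move=> e; apply/eqP; apply: contraT => ij.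
have : axis_comb (delta_mx 0 i) 0 \in axis_line j.
  by rewrite -e axis_comb_delta1 memv_span // inE eqxx.
by move/mem_axis_line => /(_ i ij)[]; rewrite mxE !eqxx => /eqP; rewrite oner_eq0.
Qed.

Lemma conj_qcoef (psi : L -> 'rV[L]_6) i :
  (forall x, conj_vec (psi x) = psi x) -> conj_vec (qcoef tau psi i) = qcoef tau psi i.+1.
Proof.
move=> psiK; rewrite conj_vec_sum; apply: eq_bigr => j _.
by rewrite conj_vecZ psiK exprVn [(q ^ i.+1)%N]expnSr (exprM (tau ^+ j)).
Qed.

Lemma conjv_axis_line i : conjv (axis_line i) = axis_line i.+1.
Proof.
have e1 : conj_vec (axis1 i) = axis1 i.+1.
  by apply: conj_qcoef => x; apply: conj_embed.
have e2 : conj_vec (axis2 i) = axis2 i.+1.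
  by apply: conj_qcoef => x; apply: conj_embed.
apply/eqP; rewrite eqEsubv; apply/andP; split.
  apply: conjv_sub => w; rewrite /axis_line span_cons span_seq1 => /memv_addP[_ /vlineP[r ->]].
  case=> _ /vlineP[s ->] ->; rewrite conj_vecD !conj_vecZ e1 e2.
  by rewrite memvD ?memvZ ?memv_span // !inE eqxx ?orbT.
apply/span_subvP=> w; rewrite !inE => /orP[] /eqP ->; rewrite -?e1 -?e2;
  by apply: mem_conjv; rewrite memv_span // !inE eqxx ?orbT.
Qed.

(** The coordinates of an embedded vector are conjugate, so they vanish
together. *)
Lemma axis_line_avoids_base (i : 'I_3) : avoids_base (axis_line i).
Proof.
move=> v v0; apply/negP => vt; have [x [y e]] := frame_surj dimL Th0 v.
move: vt; rewrite e embed_frame => /mem_axis_line off.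
have [j ji] : exists j : 'I_3, j != i.
  have [->|i0] := eqVneq i 0; first by exists 1.
  by exists 0; rewrite eq_sym.
have [/eqP + /eqP] := off j ji; rewrite !mxE !expf_eq0.
move=> /andP[_ /eqP x0] /andP[_ /eqP y0].
by rewrite e x0 y0 linear0 eqxx in v0.
Qed.

(** The vector axis1 i + k^(q^i) axis2 i lies in the extension: by [sum_expq] it
is a combination of points Th (tau^j, k tau^j). *)
Lemma axis_line_meets k (i : 'I_3) : meets (axis_line i) (extend L (plane Th 1 k)).
Proof.
apply/meetsP; exists (axis1 i + k ^+ (q ^ i) *: axis2 i); split.
- rewrite -axis_comb_delta1 -axis_comb_delta2 axis_combZ axis_combD -axis_comb0.
  apply/eqP => /axis_comb_inj[/rowP/(_ i)].
  by rewrite scaler0 !mxE !eqxx addr0 => /eqP; rewrite oner_eq0.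
- by rewrite memvD ?memvZ ?memv_span // !inE eqxx ?orbT.
have -> : axis1 i + k ^+ (q ^ i) *: axis2 i =
    \sum_(j < n) (tau ^+ j) ^- (q ^ i) *: embed (Th (1 * tau ^+ j, k * tau ^+ j)).
  under eq_bigr => j _ do rewrite mul1r embed_frame axis_combE scalerDr !scaler_sumr.
  rewrite big_split /= [X in _ = X + _]exchange_big [X in _ = _ + X]exchange_big /=.
  congr (_ + _).
    have e1 (l : 'I_3) : \sum_(j < n) (tau ^+ j) ^- (q ^ i) *:
        ((conjugates (tau ^+ j)) 0 l *: axis1 l) = (i == l)%:R *: axis1 l.
      rewrite -[(i == l)%:R](sum_expq tau_prim (ltn_ord i) (ltn_ord l)) scaler_suml.
      by apply: eq_bigr => j _; rewrite scalerA mxE.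
    under eq_bigr => l _ do rewrite e1.
    rewrite (bigD1 i) //= eqxx scale1r big1 ?addr0 // => l li.
    by rewrite eq_sym (negPf li) scale0r.
  have e2 (l : 'I_3) : \sum_(j < n) (tau ^+ j) ^- (q ^ i) *:
      ((conjugates (k * tau ^+ j)) 0 l *: axis2 l) = (k ^+ (q ^ l) * (i == l)%:R) *: axis2 l.
    rewrite -[(i == l)%:R](sum_expq tau_prim (ltn_ord i) (ltn_ord l)) mulr_sumr scaler_suml.
    by apply: eq_bigr => j _; rewrite scalerA mxE exprMn mulrCA.
  under eq_bigr => l _ do rewrite e2.
  rewrite (bigD1 i) //= eqxx mulr1 big1 ?addr0 // => l li.
  by rewrite eq_sym (negPf li) mulr0 scale0r.
apply: memv_suml => j _; rewrite memvZ // mem_extend //.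
by apply/planeP; exists (tau ^+ j).
Qed.

(** The exponents 0, q^i, q^j and q^i + q^j are distinct and less than n, the
number of elements of norm 1. *)
Lemma four_monomials_vanish (i j : nat) (A B C D : L) :
    (i < j < 3)%N ->
    (forall k : L, k ^+ n = 1 ->
       A * k ^+ (q ^ i + q ^ j) + B * k ^+ (q ^ i) + C * k ^+ (q ^ j) + D = 0) ->
  [/\ A = 0, B = 0, C = 0 & D = 0].
Proof.
move=> /andP[ij j3] vanish; have q1 := card_gt1 F.
have qi0 : (0 < q ^ i)%N by rewrite expn_gt0 ltnW.
have qij : (q ^ i < q ^ j)%N by rewrite ltn_exp2l.
have qijn : (q ^ i + q ^ j < n)%N.
  apply: (@leq_ltn_trans (q + q ^ 2)); last by rewrite addn1 ltnS addnC.
  by apply: leq_add; [rewrite -[leqRHS]expn1|]; rewrite leq_exp2l //; lia.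
pose P : {poly L} := A *: 'X^(q ^ i + q ^ j) + B *: 'X^(q ^ i) + C *: 'X^(q ^ j) + D%:P.
have P0 : P = 0.
  apply: (@roots_geq_poly_eq0 _ _ [seq zeta ^+ r | r <- iota 0 n]).
  - apply/allP=> _ /mapP[r _ ->]; rewrite rootE !hornerE vanish //.
    by rewrite exprAC (prim_expr_order (zeta_prim tau_prim)) expr1n.
  - rewrite map_inj_in_uniq ?iota_uniq // => r s; rewrite !mem_iota => lr ls /eqP.
    by rewrite (eq_prim_root_expr (zeta_prim tau_prim)) !modn_small // => /eqP.
  rewrite size_map size_iota; apply/leq_sizeP => r nr.
  rewrite !coefD !coefZ !coefXn coefC !gtn_eqF ?mulr0 ?addr0 //;
    by apply: leq_trans nr; lia.
have cP r : P`_r = 0 by rewrite P0 coef0.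
have coefP r : P`_r = A * (r == q ^ i + q ^ j)%N%:R + B * (r == q ^ i)%N%:R +
    C * (r == q ^ j)%N%:R + (if r == 0%N then D else 0).
  by rewrite !coefD !coefZ !coefXn coefC.
split.
- have := cP (q ^ i + q ^ j)%N; rewrite coefP eqxx mulr1.
  rewrite !gtn_eqF ?mulr0 ?addr0 //; lia.
- have := cP (q ^ i)%N; rewrite coefP eqxx mulr1 (ltn_eqF qij) (gtn_eqF qi0).
  rewrite ltn_eqF ?mulr0 ?addr0 ?add0r //; lia.
- have := cP (q ^ j)%N; rewrite coefP eqxx mulr1 (gtn_eqF qij).
  rewrite ltn_eqF ?gtn_eqF ?mulr0 ?addr0 ?add0r //; lia.
have := cP 0%N; rewrite coefP eqxx !ltn_eqF ?mulr0 ?add0r //; lia.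
Qed.

Section Uniqueness.
Variable h : subsp L 6.
Hypothesis dh : is_line h.
Hypothesis meet_h : forall k : L, k ^+ n = 1 -> meets h (extend L (plane Th 1 k)).
Variables a b c d : 'rV[L]_3.
Hypothesis hab : axis_comb a b \in h.
Hypothesis hcd : axis_comb c d \in h.
Hypothesis fr : free [:: axis_comb a b; axis_comb c d].

(** A common point of the line and the plane y = k x is a linear relation
between the two columns with entries k^(q^l) X_l - Y_l. The 2 x 2 minor of
its rows i and j is a polynomial in k, whose coefficients are Pluecker
coordinates of the line. *)
Lemma plucker_vanish_lt (i j : 'I_3) : (i < j)%N ->
  [/\ a 0 i * c 0 j = c 0 i * a 0 j, a 0 i * d 0 j = c 0 i * b 0 j,
      a 0 j * d 0 i = c 0 j * b 0 i & b 0 i * d 0 j = d 0 i * b 0 j].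
Proof.
move=> ij; have [||eA eB eC eD] := @four_monomials_vanish i j
    (a 0 i * c 0 j - c 0 i * a 0 j) (c 0 i * b 0 j - a 0 i * d 0 j)
    (a 0 j * d 0 i - c 0 j * b 0 i) (b 0 i * d 0 j - d 0 i * b 0 j).
- by rewrite ij ltn_ord.
- move=> k /meet_h /meetsP [w [w0 wh wk]].
  have [s [t e]] := line_span dh hab hcd wh fr.
  move: wk w0; rewrite e !axis_combZ axis_combD => /mem_extend_plane E w0.
  have := E i; have := E j; rewrite !mxE => ej ei.
  set K := k ^+ (q ^ i) in ei *; set M := k ^+ (q ^ j) in ej *.
  rewrite exprD -/K -/M.
  set al := fun l kl => kl * a 0 l - b 0 l.
  have lin (x y x' y' : L) : s * x + t * y = 0 -> s * x' + t * y' = 0 -> x * y' - y * x' = 0.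
    move=> e1 e2.
    have es : s * (x * y' - y * x') = 0.
      transitivity ((s * x + t * y) * y' - (s * x' + t * y') * y); first by ring.
      by rewrite e1 e2 !mul0r subrr.
    have et : t * (x * y' - y * x') = 0.
      transitivity ((s * x' + t * y') * x - (s * x + t * y) * x'); first by ring.
      by rewrite e1 e2 !mul0r subrr.
    apply/eqP; apply: contraNT w0 => nz; apply/eqP.
    move/eqP: es; rewrite mulf_eq0 (negPf nz) orbF => /eqP ->.
    move/eqP: et; rewrite mulf_eq0 (negPf nz) orbF => /eqP ->.
    by rewrite !scale0r !addr0 axis_comb0.
  have := lin (K * a 0 i - b 0 i) (K * c 0 i - d 0 i) (M * a 0 j - b 0 j) (M * c 0 j - d 0 j).
  move=> <-; [ring | |].
    transitivity (K * (s * a 0 i + t * c 0 i) - (s * b 0 i + t * d 0 i)); first by ring.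
    by rewrite ei subrr.
  transitivity (M * (s * a 0 j + t * c 0 j) - (s * b 0 j + t * d 0 j)); first by ring.
  by rewrite ej subrr.
by split; apply/eqP; rewrite -subr_eq0 ?eA ?eC ?eD // -oppr_eq0 opprB eB.
Qed.

Lemma plucker_vanish (i j : 'I_3) : i != j ->
  [/\ a 0 i * c 0 j = c 0 i * a 0 j, a 0 i * d 0 j = c 0 i * b 0 j
    & b 0 i * d 0 j = d 0 i * b 0 j].
Proof.
move=> ij; case: (ltngtP i j) => [/plucker_vanish_lt[]||/val_inj e] //.
  move=> /plucker_vanish_lt[e1 e2 e3 e4]; split=> //.
    by rewrite mulrC -e1 mulrC.
  by rewrite mulrC -e4 mulrC.
by rewrite e eqxx in ij.
Qed.

(** Otherwise all 2 x 2 minors vanish and the two points spanning the line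
coincide. *)
Lemma plucker_nonzero : exists i, a 0 i * d 0 i != c 0 i * b 0 i.
Proof.
have [i|all0] := pickP [pred i | a 0 i * d 0 i != c 0 i * b 0 i]; first by exists i.
pose U := row_mx a b; pose V := row_mx c d.
have minor r s : U 0 r * V 0 s = V 0 r * U 0 s.
  have diag i : a 0 i * d 0 i = c 0 i * b 0 i.
    by apply/eqP; have /negbT := all0 i; rewrite negbK.
  have sym (x y z t : L) : x * y = z * t -> t * z = y * x.
    by move=> e; rewrite mulrC -e mulrC.
  case: (split_ordP r) => i ->; case: (split_ordP s) => j ->;
    rewrite /U /V ?row_mxEl ?row_mxEr; have [<-|ij] := eqVneq i j.
  - exact: mulrC.
  - by case: (plucker_vanish ij).
  - exact: diag.
  - by case: (plucker_vanish ij).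
  - exact/sym/diag.
  - by rewrite eq_sym in ij; case: (plucker_vanish ij) => _ e _; apply: sym.
  - exact: mulrC.
  by case: (plucker_vanish ij).
move: fr; rewrite free_cons span_seq1 seq1_free => /andP[/negP nu v0].
have [r Vr] : exists r, V 0 r != 0.
  have [r ?|V0] := pickP [pred r | V 0 r != 0]; first by exists r.
  case/eqP: v0; rewrite axis_comb_row_mx -/V; suff -> : V = 0 by rewrite mul0mx.
  by apply/rowP => r; rewrite [RHS]mxE; apply/eqP; have /negbT := V0 r; rewrite negbK.
case: nu; apply/vlineP; exists (U 0 r / V 0 r).
rewrite !axis_comb_row_mx scalemxAl; congr (_ *m _); apply/rowP => s.
by rewrite [RHS]mxE mulrAC minor mulrAC mulfV // mul1r.
Qed.

(** The values of X_i and of Y_i at the two points spanning the line form two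
independent pairs, for some i. The pair of values of any other X_j or Y_j is
proportional to both, hence is zero. *)
Lemma transversal_is_axis_line : exists i : 'I_3, h = axis_line i.
Proof.
have [i det] := plucker_nonzero; exists i.
have off j : j != i -> [/\ a 0 j = 0, b 0 j = 0, c 0 j = 0 & d 0 j = 0].
  move=> ji; have ij : i != j by rewrite eq_sym.
  have [e1 e2 e3] := plucker_vanish ij; have [_ e4 _] := plucker_vanish ji.
  have kill x : x * (a 0 i * d 0 i - c 0 i * b 0 i) = 0 -> x = 0.
    by move/eqP; rewrite mulf_eq0 subr_eq0 (negPf det) orbF => /eqP.
  split; apply: kill.
  - transitivity (a 0 i * (a 0 j * d 0 i - c 0 j * b 0 i) + b 0 i * (a 0 i * c 0 j - c 0 i * a 0 j)).
      by ring.
    by rewrite e1 e4 !subrr !mulr0 addr0.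
  - transitivity (b 0 i * (a 0 i * d 0 j - c 0 i * b 0 j) - a 0 i * (b 0 i * d 0 j - d 0 i * b 0 j)).
      by ring.
    by rewrite e2 e3 !subrr !mulr0 subr0.
  - transitivity (d 0 i * (a 0 i * c 0 j - c 0 i * a 0 j) + c 0 i * (a 0 j * d 0 i - c 0 j * b 0 i)).
      by ring.
    by rewrite e1 e4 !subrr !mulr0 addr0.
  transitivity (d 0 i * (a 0 i * d 0 j - c 0 i * b 0 j) - c 0 i * (b 0 i * d 0 j - d 0 i * b 0 j)).
    by ring.
  by rewrite e2 e3 !subrr !mulr0 subr0.
have habi : axis_comb a b \in axis_line i by apply/mem_axis_line => j /off[].
have hcdi : axis_comb c d \in axis_line i by apply/mem_axis_line => j /off[].
apply/eqP; rewrite eqEdim dh (axis_line_is_line i) leqnn andbT; apply/subvP => w wh.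
have [s [t ->]] := line_span dh hab hcd wh fr.
by rewrite memvD ?memvZ.
Qed.

End Uniqueness.

Theorem exactly_three_transversals (T : {fset subsp F 6}) :
    (forall P, P \in T <-> exists k : L, k ^+ n = 1 /\ P = plane Th 1 k) ->
  has_exactly_three_transversals L T.
Proof.
move=> TP; exists (axis_line 0); rewrite !conjv_axis_line.
have mem_gs h : h \in [:: axis_line 0; axis_line 1; axis_line 2] <->
    exists i : 'I_3, h = axis_line i.
  rewrite !inE; split=> [/or3P[]/eqP ->|[i ->]].
  - by exists 0.
  - by exists 1.
  - by exists 2.
  by case: i => [[|[|[|]]] //= _]; rewrite eqxx ?orbT.
split.
- rewrite /= !inE !negb_or !andbT; apply/andP; split; first (apply/andP; split);
    apply/eqP.
  + by move/(@axis_line_inj 0 1).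
  + by move/(@axis_line_inj 0 2).
  by move/(@axis_line_inj 1 2).
- move=> h; rewrite mem_gs; split=> [[dh meet_h]|[i ->]].
    have meet_k k : k ^+ n = 1 -> meets h (extend L (plane Th 1 k)).
      by move=> kn; apply: meet_h; apply/TP; exists k.
    have [u [v [uh vh fr]]] := line_basis dh.
    have [[a [b eu]] [c [d ev]]] := (axis_comb_surj u, axis_comb_surj v).
    rewrite eu ev in uh vh fr; exact: (transversal_is_axis_line dh meet_k uh vh fr).
  split; first exact: axis_line_is_line.
  by move=> P /TP[k [_ ->]]; apply: axis_line_meets.
by move=> h /mem_gs[i ->]; apply: axis_line_avoids_base.
Qed.

End Transversals.

(** * Elements of norm 1 *)

Section Norm.
Variables (F : finFieldType) (L : fieldExtType F).
Hypothesis dimL : \dim {:L} = 3%N.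
Variable tau : L.
Hypothesis tau_prim : (#|F| ^ 3 - 1)%N.-primitive_root tau.
Local Notation q := #|F|.
Local Notation n := (#|F| ^ 2 + #|F| + 1)%N.

Lemma norm_fixed (x : L) i : (x ^+ n) ^+ (q ^ i) = x ^+ n.
Proof.
have [->|/(tauP dimL tau_prim)[j ->]] := eqVneq x 0.
  by rewrite expr0n addn1 /= expr0n expn_eq0 (gtn_eqF (ltnW (card_gt1 F))).
by rewrite (exprAC _ j) exprAC (exp_tau_n tau_prim).
Qed.

(** The norm takes its values in F, on which the Frobenius map is trivial. *)
Lemma norm1_ratio (x : L) i : x != 0 -> (x ^+ (q ^ i) / x) ^+ n = 1.
Proof.
by move=> x0; rewrite exprMn exprVn exprAC norm_fixed mulfV // expf_neq0.
Qed.

Lemma norm1_neq0 (m : L) : m ^+ n = 1 -> m != 0.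
Proof.
by apply: contra_eq_neq => ->; rewrite expr0n addn1 eq_sym oner_eq0.
Qed.

Lemma hilbert90 (m : L) : m ^+ n = 1 -> exists2 x, x != 0 & x ^+ q = m * x.
Proof.
case/(prim_rootP (zeta_prim tau_prim)) => j ->; exists (tau ^+ j).
  by rewrite expf_neq0 // (tau_neq0 tau_prim).
rewrite /zeta exprAC -exprMn -exprSr subn1 prednK ?(ltnW (card_gt1 F)) //.
Qed.

Lemma expq4 (x : L) : x ^+ (q ^ 2) ^+ (q ^ 2) = x ^+ q.
Proof.
rewrite -exprM -expnD (_ : (2 + 2 = 3 + 1)%N) // expnD exprM (expq3 dimL).
by rewrite expn1.
Qed.

(** With x = y tau the first expression is y^(q+1) d, where d = tau^q - tau.
The second one is always minus the q^2-th power of the first, so an element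
y is needed for which (y^(q+1))^(q^2 - 1) is a given element m of norm 1.
If t^q = m t, then y = t^(q^2) does it. *)
Lemma cross_surj (k : L) : k ^+ n = 1 ->
  exists x y, [/\ x != 0, y != 0, y * x ^+ q - x * y ^+ q != 0 &
    y * x ^+ (q ^ 2) - x * y ^+ (q ^ 2) = - (k * (y * x ^+ q - x * y ^+ q))].
Proof.
move=> kn; pose d := tau ^+ q - tau; have tau0 := tau_neq0 tau_prim.
have d0 : d != 0.
  have := exp_tau_inj tau_prim (i := 1) (j := 0) isT isT.
  by rewrite expn1 expn0 expr1 subr_eq0 => ->.
have dq2 : d ^+ (q ^ 2) != 0 by rewrite expf_neq0.
pose m := k * (d ^+ (q ^ 2) / d)^-1.
have mn : m ^+ n = 1 by rewrite exprMn kn exprVn norm1_ratio // invr1 mulr1.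
have [t t0 tq] := hilbert90 mn; pose y := t ^+ (q ^ 2).
have y0 : y != 0 by rewrite expf_neq0.
have yq : y ^+ q = t by rewrite -exprM -expnSr (expq3 dimL).
have yq2 : y ^+ (q ^ 2) = t ^+ q by rewrite expq4.
have D1 : y * (y * tau) ^+ q - y * tau * y ^+ q = y ^+ q * y * d.
  by rewrite exprMn /d; ring.
exists (y * tau), y; rewrite D1; split=> //.
- by rewrite mulf_neq0.
- by rewrite !mulf_neq0 // expf_neq0.
have e : tau - tau ^+ (q ^ 2) = d ^+ (q ^ 2).
  rewrite /d expqD expqN -exprM mulnC -expnSr (expq3 dimL); ring.
transitivity (- (t ^+ q * y * d ^+ (q ^ 2))).
  by rewrite exprMn yq2 -e; ring.
rewrite yq tq /m; congr (- _); field.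
by rewrite d0 dq2.
Qed.

End Norm.

(** * Exterior splashes *)

Section Splash.
Variables (F : finFieldType) (L : fieldExtType F).
Hypothesis dimL : \dim {:L} = 3%N.
Variable tau : L.
Hypothesis tau_prim : (#|F| ^ 3 - 1)%N.-primitive_root tau.
Local Notation q := #|F|.
Local Notation n := (#|F| ^ 2 + #|F| + 1)%N.
Local Notation embed := (@embed F L 3).

(** A dependence would be a polynomial of degree at most 2 over F with the three
roots tau, tau^q and tau^(q^2). *)
Lemma power_basis : basis_of fullv [tuple 1; tau; tau ^+ 2].
Proof.
rewrite basisEfree subvf dimL /= andbT; apply/freeP => c c0 i.
pose P : {poly L} := \poly_(j < 3) (c (inord j))%:A.
have Ptau l : P.[tau ^+ (q ^ l)] = 0.
  have z : 0 ^+ (q ^ l) = 0 :> L.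
    by rewrite expr0n expn_eq0 (gtn_eqF (ltnW (card_gt1 F))).
  rewrite -[RHS]z -c0 horner_poly !big_ord_recl !big_ord0 /= !expqD !expqZ z.
  rewrite !addr0 !expr1n !expr0 !mulr1 !mulr_algl !expr1 -!(exprAC _ 2).
  have io r (r3 : (r < 3)%N) : inord r = Ordinal r3.
    by apply/val_inj; rewrite /= inordK.
  rewrite !io.
  by congr (c _ *: _ + (c _ *: _ + c _ *: _)); apply/val_inj.
have P0 : P = 0.
  apply: (@roots_geq_poly_eq0 _ _ [seq tau ^+ (q ^ l) | l <- iota 0 3]).
  - by apply/allP => _ /mapP[l _ ->]; rewrite rootE Ptau.
  - rewrite map_inj_in_uniq ?iota_uniq // => l l'; rewrite !mem_iota => l3 l'3 /eqP.
    by rewrite (exp_tau_inj tau_prim) // => /eqP.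
  by rewrite size_map size_iota size_poly.
have : P`_i = 0 by rewrite P0 coef0.
by rewrite coef_poly ltn_ord inord_val => /eqP; rewrite scaler_eq0 oner_eq0 orbF => /eqP.
Qed.

Lemma bracket_inj : injective (bracket tau).
Proof.
move=> x y /rowP e; rewrite (coord_basis power_basis (memvf x)).
rewrite (coord_basis power_basis (memvf y)); apply: eq_bigr => i _.
by have := e i; rewrite !mxE => ->.
Qed.

Definition bb_coords (p : L * L) : 'rV[F]_6 := row_mx (bracket tau p.1) (bracket tau p.2).

Fact bb_coords_is_linear : linear bb_coords.
Proof.
move=> k x y; apply/rowP=> i; rewrite !mxE.
by case: split => j; rewrite !mxE linearP.
Qed.

HB.instance Definition _ :=
  GRing.isLinear.Build F (L * L)%type 'rV[F]_6 _ bb_coords bb_coords_is_linear.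

Definition bb_frame := linfun bb_coords.

Lemma bb_frame0 : lker bb_frame == 0%VS.
Proof.
apply/lker0P => -[x y] [x' y']; rewrite !lfunE /= /bb_coords => e.
have [] := @eq_row_mx _ 1 3 3 _ _ _ _ e.
by move=> /bracket_inj /= -> /bracket_inj /= ->.
Qed.

Lemma bb_planeE a b : bb_plane tau a b = plane bb_frame a b.
Proof.
apply/vspaceP => v; apply/idP/planeP => [/mem_bb_plane[x ->]|[x ->]].
  by exists x; rewrite lfunE.
by apply/mem_bb_plane; exists x; rewrite lfunE.
Qed.

(** The third coordinate, which vanishes exactly on the line at infinity. *)
Definition height (A : 'M[L]_3) (v : 'rV[F]_3) : L := (embed v *m A) 0 2.

Fact height_is_linear A : linear (height A).
Proof.
move=> c u v; rewrite /height embedD embedZ mulmxDl -scalemxAl !mxE.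
by rewrite mulr_algl.
Qed.

HB.instance Definition _ A :=
  GRing.isLinear.Build F 'rV[F]_3 L _ (height A) (height_is_linear A).

Lemma embed_eq0 (v : 'rV[F]_3) : embed v = 0 -> v = 0.
Proof.
move=> /rowP e; apply/rowP => i; have := e i; rewrite !mxE => /eqP.
by rewrite scaler_eq0 oner_eq0 orbF => /eqP.
Qed.

Lemma ord3 (i : 'I_3) : [\/ i = 0, i = 1 | i = 2].
Proof.
case: i => [[|[|[|//]]] lt]; [constructor 1|constructor 2|constructor 3]; exact/val_inj.
Qed.

(** An exterior subplane has no point of height 0, so the height is an F-linear
bijection and can serve as parameter. The last property says that the points
of a subplane span the plane. *)
Lemma subplane_param (pi : {fset subsp L 3}) :
    is_subplane pi -> is_exterior pi ->
  exists pt : L -> 'rV[L]_3,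
    [/\ forall X, X \in pi <-> exists2 x, x != 0 & X = <[pt x]>%VS,
        forall (c : F) x y, pt (c *: x + y) = c%:A *: pt x + pt y,
        forall x, pt x 0 2 = x
      & forall w : 'cV[L]_3, (forall x, pt x *m w = 0) -> w = 0].
Proof.
case=> A Aunit piP ext; pose h := linfun (height A).
have h0 : lker h == 0%VS.
  rewrite -subv0; apply/subvP => v; rewrite memv_ker lfunE /= => /eqP v2.
  rewrite memv0; apply: contraT => v0.
  case: (ext <[embed v *m A]>%VS); first by apply/piP; exists v.
  set w := embed v *m A; exists (w 0 0), (w 0 1).
  have wE : w = \row_(i < 3) [:: w 0 0; w 0 1; 0]`_i.
    by apply/rowP => i; rewrite [RHS]mxE; case: (ord3 i) => ->.
  split; last by rewrite /pt_inf -wE.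
  apply: contra v0; rewrite xpair_eqE => /andP[/eqP w0 /eqP w1].
  have w00 : w = 0.
    by apply/rowP => i; rewrite wE w0 w1 !mxE; case: (ord3 i) => ->.
  by apply/eqP/embed_eq0; rewrite -(mulmxK Aunit (embed v)) -/w w00 mul0mx.
have hK x : height A (h^-1%VF x) = x.
  have : x \in limg h.
    suff -> : limg h = fullv by apply: memvf.
    apply/eqP; rewrite eqEdim subvf limg_dim_eq; last by rewrite (eqP h0) capv0.
    by rewrite dimL dimvf dim_matrix.
  by move/limg_lfunVK; rewrite lfunE.
have Kh v : h^-1%VF (height A v) = v.
  by have := lker0_lfunK h0 v; rewrite lfunE.
exists (fun x => embed (h^-1%VF x) *m A); split.
- move=> X; rewrite piP; split=> [[v v0 ->]|[x x0 ->]].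
    exists (height A v); last by rewrite Kh.
    by apply: contraNneq v0 => e; rewrite -(Kh v) e linear0.
  exists (h^-1%VF x) => //; apply: contraNneq x0 => e.
  by rewrite -(hK x) e linear0.
- by move=> c x y; rewrite linearP embedD embedZ mulmxDl scalemxAl.
- exact: hK.
move=> w w0; rewrite -(mulKmx Aunit w); suff -> : A *m w = 0 by rewrite mulmx0.
apply/row_matrixP => i; rewrite row0 rowE mulmxA -embed_delta -(Kh (delta_mx 0 i)).
exact: w0.
Qed.

(** The frame maps (x, y) to the pair of coordinates of x e1 - y e2 at infinity. *)
Theorem splash_frame (S : {fset subsp F 6}) :
    is_exterior_splash tau S ->
  exists Th : 'Hom((L * L)%type, 'rV[F]_6), lker Th == 0%VS /\
    forall P, P \in S <-> exists k : L, k ^+ n = 1 /\ P = plane Th 1 k.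
Proof.
case=> pi [pi_sub pi_ext SP].
have [pt [ptP pt_lin pt2 pt_full]] := subplane_param pi_sub pi_ext.
pose e i := qcoef tau pt i.
have ptE x i : pt x 0 i = x * e 0%N 0 i + x ^+ q * e 1%N 0 i + x ^+ (q ^ 2) * e 2%N 0 i.
  rewrite (linear_expansion dimL tau_prim pt_lin x) !big_ord_recl big_ord0 addr0.
  by rewrite !mxE expr1 addrA.
have e2 i : (i < 3)%N -> e i 0 2 = (i == 0%N)%:R.
  move=> i3; rewrite -(sum_expq tau_prim i3 (isT : 0 < 3)%N) summxE.
  by apply: eq_bigr => j _; rewrite !mxE pt2 expr1.
set a1 := e 1%N 0 0; set b1 := e 1%N 0 1; set a2 := e 2%N 0 0; set b2 := e 2%N 0 1.
have indep l m : a1 * l + b1 * m = 0 -> a2 * l + b2 * m = 0 -> l = 0 /\ m = 0.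
  move=> E1 E2.
  pose w : 'cV[L]_3 := \col_(i < 3) [:: l; m; - (e 0%N 0 0 * l + e 0%N 0 1 * m)]`_i.
  have /colP w0 : w = 0.
    apply: pt_full => x; apply/rowP => i; rewrite !mxE !big_ord_recl big_ord0 !mxE /=.
    have -> : lift ord0 ord0 = 1 :> 'I_3 by apply/val_inj.
    have -> : lift ord0 (lift ord0 ord0) = 2 :> 'I_3 by apply/val_inj.
    rewrite pt2 !ptE -/a1 -/b1 -/a2 -/b2.
    transitivity (x ^+ q * (a1 * l + b1 * m) + x ^+ (q ^ 2) * (a2 * l + b2 * m)).
      by ring.
    by rewrite E1 E2 !mulr0 addr0.
  by split; [have := w0 0 | have := w0 1]; rewrite !mxE.
have det : a1 * - b2 != b1 * - a2.
  apply/eqP; rewrite !mulrN => /oppr_inj D.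
  have [||b10 /eqP] := indep b1 (- a1); rewrite ?mulrN; first by rewrite mulrC subrr.
    by rewrite mulrC -D mulrC subrr.
  rewrite oppr_eq0 => /eqP a10.
  have [||b20 /eqP] := indep b2 (- a2); rewrite ?mulrN; first by rewrite D subrr.
    by rewrite mulrC subrr.
  rewrite oppr_eq0 => /eqP a20.
  have [||/eqP] := indep 1 0; rewrite ?a10 ?b10 ?a20 ?b20 ?mul0r ?addr0 //.
  by rewrite oner_eq0.
pose Th := reframe (bb_frame) a1 b1 (- a2) (- b2).
exists Th; split; first by apply: reframe0 => //; apply: bb_frame0.
pose vec a b : 'rV[L]_3 := \row_(i < 3) [:: a; b; 0]`_i.
(* The join of two points of the subplane meets the line at infinity here. *)
have cross x y D1 D2 : D1 = y * x ^+ q - x * y ^+ q ->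
    D2 = y * x ^+ (q ^ 2) - x * y ^+ (q ^ 2) ->
    y *: pt x - x *: pt y = vec (D1 * a1 + D2 * a2) (D1 * b1 + D2 * b2).
  move=> -> ->; apply/rowP => i; rewrite !mxE.
  case: (ord3 i) => ->; rewrite ?ptE /= -/a1 -/b1 -/a2 -/b2; [ring | ring |].
  by rewrite !e2 //=; ring.
have vec_inj a b a' b' : vec a b = vec a' b' -> a = a' /\ b = b'.
  by move=> /rowP E; split; [have := E 0 | have := E 1]; rewrite !mxE.
have vec_scale c a b : c *: vec a b = vec (c * a) (c * b).
  by apply/rowP => i; rewrite !mxE; case: (ord3 i) => -> //=; rewrite mulr0.
have planeE k : plane Th 1 k = plane bb_frame (a1 - k * a2) (b1 - k * b2).
  by rewrite plane_reframe !mul1r !mulrN.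
have nz k : (a1 - k * a2, b1 - k * b2) != (0, 0).
  apply: contraNneq det => -[/subr0_eq Ea /subr0_eq Eb].
  by rewrite Ea Eb; apply/eqP; ring.
move=> P; rewrite SP; split.
  case=> a [b [ab [_ [P1 [P2 [/ptP[x x0 ->] /ptP[y y0 ->] _ sub]]]] ->]].
  have : vec a b \in (<[pt x]> + <[pt y]>)%VS by rewrite memvE.
  case/memv_addP => _ /vlineP[r ->] [_ /vlineP[s ->] E].
  have rs : r * x + s * y = 0.
    by have := congr1 (fun w : 'rV[L]_3 => w 0 2) E; rewrite !mxE !pt2.
  pose t := - s / x; have rE : r = t * y.
    rewrite /t mulrAC; apply: (mulIf x0); rewrite divfK // mulNr.
    by apply/eqP; rewrite -addr_eq0 rs.
  have sE : s = - (t * x) by rewrite /t divfK // opprK.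
  pose D1 := y * x ^+ q - x * y ^+ q; pose D2 := y * x ^+ (q ^ 2) - x * y ^+ (q ^ 2).
  have D2E : D2 = - D1 ^+ (q ^ 2).
    rewrite /D1 expqD expqN !exprMn -!(exprM _ q) -expnS !(expq3 dimL).
    by rewrite /D2; ring.
  move: E; rewrite rE sE scaleNr -(scalerA t y) -(scalerA t x) -scalerBr (cross x y D1 D2) //.
  rewrite vec_scale => /vec_inj[aE bE].
  have tD : t * D1 != 0.
    apply: contraNneq ab => /eqP; rewrite mulf_eq0 aE bE => /orP[] /eqP z.
      by rewrite z !mul0r.
    by rewrite D2E z expr0n expn_eq0 (gtn_eqF (ltnW (card_gt1 F))) oppr0 !mul0r addr0 mulr0.
  have [t0 D10] : t != 0 /\ D1 != 0 by move: tD; rewrite mulf_eq0 => /norP.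
  exists (D1 ^+ (q ^ 2) / D1); split; first exact: (norm1_ratio dimL tau_prim).
  rewrite planeE bb_planeE -[RHS](plane_scale _ _ _ tD); congr plane.
    by rewrite aE D2E; field.
  by rewrite bE D2E; field.
case=> k [kn ->]; have [x [y [x0 y0]]] := cross_surj dimL tau_prim kn.
set D1 := _ - _; set D2 := y * x ^+ (q ^ 2) - _ => D10 D2E.
have crossE := cross x y D1 D2 erefl erefl.
have aE : D1 * a1 + D2 * a2 = (a1 - k * a2) * D1 by rewrite D2E; ring.
have bE : D1 * b1 + D2 * b2 = (b1 - k * b2) * D1 by rewrite D2E; ring.
rewrite aE bE in crossE; set a := _ * D1 in crossE; set b := _ * D1 in crossE.
have ab : (a, b) != (0, 0).
  apply: contraNneq (nz k) => -[/eqP + /eqP].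
  by rewrite !mulf_eq0 (negPf D10) !orbF => /eqP -> /eqP ->.
exists a, b; split=> //; last by rewrite planeE bb_planeE plane_scale.
split; first by exists a, b.
exists <[pt x]>%VS, <[pt y]>%VS; split.
- by apply/ptP; exists x.
- by apply/ptP; exists y.
- move=> E; have : vec a b \in <[pt x]>%VS.
    by rewrite -crossE memvB ?memvZ ?memv_line // E memv_line.
  case/vlineP => r Er; case/eqP: ab.
  have : r * x = 0 by have := congr1 (fun w : 'rV[L]_3 => w 0 2) Er; rewrite !mxE pt2.
  move=> /eqP; rewrite mulf_eq0 (negPf x0) orbF => /eqP r0.
  have [-> ->] // : a = 0 /\ b = 0.
  apply: vec_inj; rewrite Er r0 scale0r; apply/rowP => i.
  by rewrite !mxE; case: (ord3 i) => ->.
rewrite /pt_inf -[X in <[X]>%VS]/(vec a b) -crossE -memvE -scaleNr.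
by rewrite memv_add ?memvZ ?memv_line.
Qed.

End Splash.

(** * Covers of a splash *)

Section Covers.
Variables (F : finFieldType) (L : fieldExtType F).
Hypothesis dimL : \dim {:L} = 3%N.
Variable tau : L.
Hypothesis tau_prim : (#|F| ^ 3 - 1)%N.-primitive_root tau.
Local Notation q := #|F|.
Local Notation n := (#|F| ^ 2 + #|F| + 1)%N.
Local Notation zeta := (zeta tau).

(** Carries the graph of k x to that of k x^(q^j) with i + j = 3. *)
Definition frob_left (i : nat) (p : L * L) : L * L := (p.1 ^+ (q ^ i), p.2).

Fact frob_left_is_linear i : linear (frob_left i).
Proof. by move=> c x y; rewrite /frob_left /= expqD expqZ. Qed.

HB.instance Definition _ i :=
  GRing.isLinear.Build F (L * L)%type (L * L)%type _ (frob_left i)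
    (frob_left_is_linear i).

Lemma frob_left_inj i : injective (frob_left i).
Proof.
move=> [x y] [x' y'] [/= e ->]; congr (_, _); apply/eqP.
have : (x - x') ^+ (q ^ i) == 0 by rewrite expqD expqN e subrr.
by rewrite expf_eq0 subr_eq0 => /andP[].
Qed.

(** An injective family of n elements of norm 1 is a permutation of all of them. *)
Lemma sum_cyclic (f : 'I_n -> L) (g : L -> L) :
    (forall j, f j ^+ n = 1) -> injective f ->
  \sum_(j < n) g (f j) = \sum_(j < n) g (zeta ^+ j).
Proof.
move=> fn fI.
have zI : injective (fun j : 'I_n => zeta ^+ j).
  move=> i j /eqP; rewrite (eq_prim_root_expr (zeta_prim tau_prim)).
  by rewrite !modn_small // => /eqP/val_inj.
have uf : uniq (codom f) by rewrite map_inj_uniq ?enum_uniq.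
have uz : uniq (codom (fun j : 'I_n => zeta ^+ j)) by rewrite map_inj_uniq ?enum_uniq.
have sub : {subset codom f <= codom (fun j : 'I_n => zeta ^+ j)}.
  move=> _ /codomP[j ->]; have [i ->] := prim_rootP (zeta_prim tau_prim) (fn j).
  by apply/codomP; exists i.
have [_ eq_codom] := uniq_min_size uf sub (eq_leq (etrans (size_codom _) (esym (size_codom _)))).
have sum_codom (f' : 'I_n -> L) : \sum_(j < n) g (f' j) = \sum_(z <- codom f') g z.
  by rewrite /codom /image_mem big_map big_enum.
by rewrite !sum_codom (perm_big _ (uniq_perm uf uz eq_codom)).
Qed.

Section Frame.
Variable Th : 'Hom((L * L)%type, 'rV[F]_6).
Hypothesis Th0 : lker Th == 0%VS.

Section Classification.
Variable Q : subsp F 6.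
Hypothesis dQ : is_plane Q.
Hypothesis Q_norm : forall x y, Th (x, y) \in Q -> exists k, k ^+ n = 1 /\ y = k * x.
Hypothesis Q_point :
  forall k, k ^+ n = 1 -> meets_in_point (plane Th 1 k) Q.

(** The cover plane Q contains no vertical point, so its first projection is
injective, hence onto. *)
Lemma graph_exists x : exists y, Th (x, y) \in Q.
Proof.
pose pr : 'Hom('rV[F]_6, L) := (linfun fst \o Th^-1)%VF.
have prE u v : pr (Th (u, v)) = u.
  by rewrite comp_lfunE lker0_lfunK // lfunE.
have : x \in (pr @: Q)%VS.
  suff -> : (pr @: Q)%VS = fullv by apply: memvf.
  apply/eqP; rewrite eqEdim subvf dimL limg_dim_eq ?dQ //.
  apply/eqP; rewrite -subv0; apply/subvP => w.
  have [u [v ->]] := frame_surj dimL Th0 w.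
  rewrite memv_cap memv_ker prE => /andP[/Q_norm[k [_ ->]] /eqP ->].
  by rewrite mulr0 memv0 linear0.
case/memv_imgP => w wQ ->; have [u [v e]] := frame_surj dimL Th0 w.
by exists v; rewrite e prE -e.
Qed.

Definition slope x := xchoose (graph_exists x).

Lemma slopeP x : Th (x, slope x) \in Q. Proof. exact: (xchooseP (graph_exists x)). Qed.

Lemma slope_uniq x y : Th (x, y) \in Q -> y = slope x.
Proof.
move=> xy; have : Th (0, y - slope x) \in Q.
  have -> : (0, y - slope x) = (x, y) - (x, slope x) :> L * L.
    by congr (_, _); rewrite /= subrr.
  by rewrite linearB memvB // slopeP.
by case/Q_norm => k [_ /eqP]; rewrite mulr0 subr_eq0 => /eqP.
Qed.

Lemma slope_linear (c : F) x y : slope (c *: x + y) = c%:A *: (slope x : L^o) + slope y.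
Proof.
apply/esym/slope_uniq.
have -> : (c *: x + y, c%:A *: (slope x : L^o) + slope y) =
          c *: (x, slope x) + (y, slope y) :> L * L.
  by congr (_, _); rewrite /= -[_ *: (_ : L^o)]/(_ * _) mulr_algl.
by rewrite linearP memvD ?memvZ ?slopeP.
Qed.

Let ratio (j : 'I_n) := slope (tau ^+ j) / tau ^+ j.

Let tau0 j : tau ^+ j != 0.
Proof. by rewrite expf_neq0 // (tau_neq0 tau_prim). Qed.

Lemma ratio_norm j : ratio j ^+ n = 1.
Proof.
have [k [kn e]] := Q_norm (slopeP (tau ^+ j)).
by rewrite /ratio e mulfK.
Qed.

(** Two indices with the same ratio k give two points of Q on the plane y = k x,
so tau^i and tau^j differ by a factor in F. *)
Lemma ratio_inj : injective ratio.
Proof.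
move=> i j e; have kn := ratio_norm i.
have memr l : ratio l = ratio i ->
    Th (tau ^+ l, ratio i * tau ^+ l) \in (plane Th 1 (ratio i) :&: Q)%VS.
  move=> <-; rewrite memv_cap; apply/andP; split.
    by apply/planeP; exists (tau ^+ l); rewrite mul1r.
  by rewrite /ratio divfK // slopeP.
have := memr i erefl; have := memr j (esym e).
pose w := Th (tau ^+ i, ratio i * tau ^+ i).
have : (plane Th 1 (ratio i) :&: Q)%VS = <[w]>%VS.
  apply/esym/eqP; rewrite eqEdim -memvE memr //= (Q_point kn) dim_vline.
  by rewrite frame_neq0 // xpair_eqE negb_and tau0.
move=> -> /vlineP[c]; rewrite -linearZ => /(lker0P Th0) -[Eji _] _.
have : (tau ^+ j) ^+ (q - 1) = (tau ^+ i) ^+ (q - 1).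
  have c0 : c != 0 by apply: contraNneq (tau0 j) => c0; rewrite Eji c0 scale0r.
  have cq : (c%:A : L) ^+ (q - 1) = 1.
    have cA0 : (c%:A : L) != 0 by rewrite scaler_eq0 oner_eq0 orbF.
    apply: (mulfI cA0); rewrite -exprS subn1 prednK ?(ltnW (card_gt1 F)) // mulr1.
    by rewrite -[q in LHS]expn1 in_alg_expq.
  by rewrite Eji -mulr_algl exprMn cq mul1r.
rewrite !(exprAC _ _ (q - 1)) -/zeta => /eqP.
rewrite (eq_prim_root_expr (zeta_prim tau_prim)) !modn_small //.
by move=> /eqP/val_inj.
Qed.

(** The coefficient of x is the sum of the ratios, and is 0 because the sum of
all n-th roots of unity is. With z = zeta^j the ratio is A z + B z^(q+1), and
in its (q+1)-st power only the term A B^q z^n has an exponent divisible by n;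
this power sum is also 0, so A = 0 or B = 0. *)
Lemma slope_monomial :
  exists i k, [/\ (i == 1%N) || (i == 2%N), k ^+ n = 1 & forall x, slope x = k * x ^+ (q ^ i)].
Proof.
pose a i : L := qcoef tau (slope : L -> L^o) i.
have slopeE x : slope x = x * a 0%N + x ^+ q * a 1%N + x ^+ (q ^ 2) * a 2%N.
  rewrite (@linear_expansion _ _ dimL _ tau_prim L^o slope slope_linear x).
  rewrite !big_ord_recl big_ord0.
  by rewrite addr0 addrA expr1.
have q1 := card_gt1 F; have n2 := lt_2q1_n F.
have sum0 := @sum_zeta F L tau tau_prim.
have a0 : a 0%N = 0.
  transitivity (\sum_(j < n) ratio j).
    by apply: eq_bigr => j _; rewrite expr1 /ratio mulrC.
  rewrite (sum_cyclic id ratio_norm ratio_inj).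
  by have := sum0 1%N; rewrite expr1; apply; lia.
have ratioE j : ratio j = a 1%N * zeta ^+ j + a 2%N * (zeta ^+ j) ^+ (q + 1).
  have t0 := tau0 j; set t := tau ^+ j in t0 *.
  have zt : zeta ^+ j = t ^+ (q - 1) by rewrite /zeta exprAC.
  have ztq : zeta ^+ j * t = t ^+ q by rewrite zt -exprSr subn1 prednK // ltnW.
  have ztq2 : (zeta ^+ j) ^+ (q + 1) * t = t ^+ (q ^ 2).
    by rewrite exprD expr1 -mulrA ztq -exprMn ztq -exprM.
  by rewrite /ratio -/t slopeE a0 -ztq -ztq2; field.
have ab : a 1%N * a 2%N ^+ q = 0.
  transitivity (\sum_(j < n) ratio j ^+ (q + 1)); last first.
    rewrite (sum_cyclic (fun z => z ^+ (q + 1)) ratio_norm ratio_inj).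
    under eq_bigr do rewrite exprAC.
    by apply: sum0; lia.
  have zn j : (zeta ^+ j) ^+ n = 1.
    by rewrite exprAC (prim_expr_order (zeta_prim tau_prim)) expr1n.
  transitivity (\sum_(j < n) (a 1%N * a 1%N ^+ q * (zeta ^+ (q + 1)) ^+ j +
      a 1%N * a 2%N ^+ q + a 2%N * a 1%N ^+ q * (zeta ^+ (2 * q + 1)) ^+ j +
      a 2%N * a 2%N ^+ q * (zeta ^+ q) ^+ j)).
    have [lt1 [lt2 lt3]] : (0 < q + 1 < n)%N /\ (0 < 2 * q + 1 < n)%N /\ (0 < q < n)%N.
      by split; [|split]; lia.
    rewrite !big_split /= -!mulr_sumr (sum0 _ lt1) (sum0 _ lt2) (sum0 _ lt3).
    rewrite !mulr0 !addr0 add0r.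
    by rewrite sumr_const card_ord -mulr_natr n_eq1 mulr1.
  apply: eq_bigr => j _; rewrite !(exprAC zeta _ j) ratioE.
  move: (zeta ^+ j) (zn j) => z znj.
  have zw : z * (z ^+ (q + 1)) ^+ q = 1.
    by rewrite -exprM -exprS -znj; congr (_ ^+ _); lia.
  have addq (u v : L) : (u + v) ^+ q = u ^+ q + v ^+ q := rmorphD (@frobenius F L) u v.
  rewrite [RHS]exprD expr1 addq (exprMn q (a 1%N)) (exprMn q (a 2%N)).
  have -> : z ^+ (2 * q + 1) = z * z ^+ q * z ^+ q.
    by rewrite -exprS -exprD; congr (_ ^+ _); lia.
  have zq : z ^+ (q + 1) = z * z ^+ q by rewrite addn1 exprS.
  move: zw; rewrite zq; set w := (z * _) ^+ q => zw.
  transitivity (a 1%N * a 1%N ^+ q * (z * z ^+ q) + a 1%N * a 2%N ^+ q * (z * w) +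
    a 2%N * a 1%N ^+ q * (z * z ^+ q * z ^+ q) + a 2%N * a 2%N ^+ q * (z ^+ q * (z * w))).
    by rewrite zw !mulr1.
  by ring.
have a_norm i : (forall x, slope x = a i * x ^+ (q ^ i)) -> a i ^+ n = 1.
  move=> E; have [k [kn]] := Q_norm (slopeP 1).
  by rewrite E expr1n !mulr1 => ->.
move/eqP: ab; rewrite mulf_eq0 expf_eq0 (ltnW q1) /= => /orP[] /eqP z.
  have E x : slope x = a 2%N * x ^+ (q ^ 2) by rewrite slopeE a0 z !mulr0 !add0r mulrC.
  by exists 2%N, (a 2%N); split=> //; apply: a_norm.
have E x : slope x = a 1%N * x ^+ (q ^ 1).
  by rewrite slopeE a0 z !mulr0 add0r addr0 mulrC expn1.
by exists 1%N, (a 1%N); split=> //; apply: a_norm.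
Qed.

End Classification.

Variables S T : {fset subsp F 6}.
Hypothesis SP :
  forall P, P \in S <-> exists k : L, k ^+ n = 1 /\ P = plane Th 1 k.
Hypothesis T_planes : plane_set n T.
Hypothesis T_disjoint : mutually_disjoint T.
Hypothesis T_covers : forall X : subsp F 6, is_point X -> covered T X -> covered S X.
Hypothesis T_meets : forall P Q, P \in S -> Q \in T -> meets_in_point P Q.

Lemma cover_plane Q : Q \in T ->
  exists i k, [/\ (i == 1%N) || (i == 2%N), k ^+ n = 1
                 & forall x, Th (x, k * x ^+ (q ^ i)) \in Q].
Proof.
move=> QT; have dQ : is_plane Q by case: T_planes => _; apply.
have Qn x y : Th (x, y) \in Q -> exists k, k ^+ n = 1 /\ y = k * x.
  move=> xyQ; have [e|xy0] := eqVneq (x, y) (0, 0).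
    by case: e => -> ->; exists 1; rewrite expr1n mulr0.
  pose w := Th (x, y).
  have [||P PS] := T_covers (X := <[w]>%VS).
  - by rewrite /is_point dim_vline frame_neq0.
  - by exists Q => //; rewrite -memvE.
  rewrite -memvE; have /SP[k [kn ->]] := PS.
  case/planeP => z /(lker0P Th0) []; rewrite mul1r => -> ->.
  by exists k.
have Qp k : k ^+ n = 1 -> meets_in_point (plane Th 1 k) Q.
  by move=> kn; apply: T_meets => //; apply/SP; exists k.
have [i [k [i12 kn E]]] := slope_monomial dQ Qn Qp.
by exists i, k; split=> // x; rewrite -E slopeP.
Qed.

(** Two planes y = u x^q and y = v x^(q^2) with u and v of norm 1 meet by
Hilbert 90, so disjointness forces the planes of T to be all of one type;
counting then shows that no slope is missing. *)
Theorem cover_frame :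
  exists Th' : 'Hom((L * L)%type, 'rV[F]_6), lker Th' == 0%VS /\
    forall P, P \in T <-> exists k : L, k ^+ n = 1 /\ P = plane Th' 1 k.
Proof.
have [Q0 Q0T] : exists Q0, Q0 \in T.
  apply/fset0Pn; rewrite -cardfs_gt0; case: T_planes => -> _.
  by rewrite addn1.
have [i [k0 [i12 k0n Q0P]]] := cover_plane Q0T.
have sameT Q : Q \in T -> exists k, k ^+ n = 1 /\ forall x, Th (x, k * x ^+ (q ^ i)) \in Q.
  move=> QT; have [j [k [j12 kn QP]]] := cover_plane QT.
  have [ij|ij] := eqVneq i j; first by exists k; rewrite ij.
  have [x x0 e] : exists2 x, x != 0 & k0 * x ^+ (q ^ i) = k * x ^+ (q ^ j).
    (* If t^q = (u / v) t, then x = t^(q^2) solves the equation, as x^q = t. *)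
    have ratio1 (u v : L) : u ^+ n = 1 -> v ^+ n = 1 ->
        exists2 x, x != 0 & u * x ^+ (q ^ 1) = v * x ^+ (q ^ 2).
      move=> un vn; have v0 := norm1_neq0 vn.
      have [|t t0 tq] := hilbert90 tau_prim (m := u / v).
        by rewrite exprMn exprVn un vn invr1 mulr1.
      exists (t ^+ (q ^ 2)); first by rewrite expf_neq0.
      rewrite (expq4 dimL) -exprM -expnD (expq3 dimL) tq.
      by rewrite mulrA mulrCA mulfV // mulr1.
    case/orP: i12 ij => /eqP ->; case/orP: j12 => /eqP -> // _.
      exact: ratio1.
    by have [x x0 e] := ratio1 _ _ kn k0n; exists x.
  have [->|/eqP nQ] := eqVneq Q Q0; first by exists k0.
  have Q0x := Q0P x; rewrite e in Q0x.
  have /(frame_eq0 Th0)[x00 _] := disjointvP (T_disjoint QT Q0T nQ) (QP x) Q0x.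
  by rewrite x00 eqxx in x0.
pose Th' := (Th \o linfun (frob_left (3 - i)))%VF.
have Th0' : lker Th' == 0%VS by apply: lker_comp0 => //; apply: frob_left_inj.
have Th'E x y : Th' (x, y) = Th (x ^+ (q ^ (3 - i)), y) by rewrite comp_lfunE lfunE.
exists Th'; split=> //.
have sub Q : Q \in T -> exists k, k ^+ n = 1 /\ Q = plane Th' 1 k.
  move=> QT; have [k [kn QP]] := sameT Q QT; exists k; split=> //.
  have dQ : is_plane Q by case: T_planes => _; apply.
  apply/esym/eqP; rewrite eqEdim (dim_plane dimL Th0') ?pair10 // dQ andbT.
  apply/subvP => _ /planeP[x ->]; rewrite Th'E mul1r.
  have {2}-> : x = (x ^+ (q ^ (3 - i))) ^+ (q ^ i).
    rewrite -exprM -expnD subnK ?(expq3 dimL) //.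
    by case/orP: i12 => /eqP ->.
  exact: QP.
pose M := [fset P in [seq plane Th' 1 (zeta ^+ j) | j <- iota 0 n]]%fset.
have TM : T = M.
  apply/eqP; rewrite eqEfcard; apply/andP; split.
    apply/fsubsetP => Q /sub[k [kn ->]]; rewrite inE.
    have [j ->] := prim_rootP (zeta_prim tau_prim) kn.
    by apply: (map_f (fun j => plane Th' 1 (zeta ^+ j))); rewrite mem_iota /= add0n.
  case: T_planes => -> _; rewrite card_fseq (leq_trans (size_undup _)) //.
  by rewrite size_map size_iota.
move=> P; split; first exact: sub.
case=> k [kn ->]; rewrite TM inE.
have [j ->] := prim_rootP (zeta_prim tau_prim) kn.
by apply: (map_f (fun j => plane Th' 1 (zeta ^+ j))); rewrite mem_iota /= add0n.
Qed.

End Frame.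

Corollary cover_transversals_and_spread (S T : {fset subsp F 6}) :
    is_exterior_splash tau S -> plane_set n T -> mutually_disjoint T ->
    (forall X : subsp F 6, is_point X -> covered T X -> covered S X) ->
    (forall P Q, P \in S -> Q \in T -> meets_in_point P Q) ->
  has_exactly_three_transversals L T /\
  exists! R : {fset subsp F 6}, is_regular_spread R /\ (T `<=` R)%fset.
Proof.
move=> /(splash_frame dimL tau_prim)[Th [Th0 SP]] Tn Td Tc Tm.
have [Th' [Th0' TP]] := cover_frame Th0 SP Tn Td Tc Tm.
split; first exact: (exactly_three_transversals dimL tau_prim Th0' TP).
exists (line_spread Th'); split; last first.
  by move=> R [regR TR]; apply/esym/(regular_spread_unique dimL tau_prim Th0' TP).
split; first exact: line_spread_regular.
apply/fsubsetP => P /TP[k [_ ->]]; apply/pencilP; right.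
by exists k => //; apply: mem_all_scalars.
Qed.

End Covers.

Local Open Scope fset_scope.

Theorem theorem6p2 (F : finFieldType) (L : fieldExtType F)
  (dimL : \dim {:L} = 3%N) (tau : L)
  (tau_prim : (#|F| ^ 3 - 1)%N.-primitive_root tau)
  (S T C : {fset subsp F 6})
  (splashS : is_exterior_splash tau S) (coversTC : are_covers S T C) :
  (has_exactly_three_transversals L T /\
   exists! R : {fset subsp F 6}, is_regular_spread R /\ T `<=` R) /\
  (has_exactly_three_transversals L C /\
   exists! R : {fset subsp F 6}, is_regular_spread R /\ C `<=` R).
Proof.
case: coversTC => -[Tn Cn] [Td Cd] cov [STm SCm _].
split; apply: (cover_transversals_and_spread dimL tau_prim splashS) => //.
  by move=> X /cov[[]].
by move=> X /cov[_ []].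
Qed.
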